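(* Let $X_1,X_2,\dots$ be i.i.d. with law $P_{S^3,\theta^*}$ where $\theta^*=(0,\tau_1^{*2},\tau_2^{*2})$, $\tau_1^{*2},\tau_2^{*2}>0$ (i.e. the true structure is the independence model $S^3$), and let $\mathcal{D}_{\mathrm{obs}}=(X_i)_{1\le i\le n}$. Assume that the prior densities $\pi(\theta\mid S)$ are four times differentiable for every $S\in\{S^1,S^2,S^3\}$. Then, as $n\to\infty$, $$\sqrt{n}\,\bigl(1-\pi(S^3\mid\mathcal{D}_{\mathrm{obs}})\bigr)=O_p(1),$$ where $O_p(1)$ means bounded in probability.
   Context: Models. Let $\Theta=\mathbb{R}\times(0,\infty)^2$ with elements $\theta=(w,\tau_1^2,\tau_2^2)$. Let $\epsilon=(\epsilon(1),\epsilon(2))$ be centered Gaussian with covariance $\mathrm{Diag}(\tau_1^2,\tau_2^2)$. For each structure $S$ and parameter $\theta$, $P_{S,\theta}$ is the law of $X=(X(1),X(2))\in\mathbb{R}^2$ given by: - $S^1$: $X(2)=\epsilon(2)$, $X(1)=wX(2)+\epsilon(1)$ (edge $X(2)\to X(1)$); - $S^2$: $X(1)=\epsilon(1)$, $X(2)=wX(1)+\epsilon(2)$ (edge $X(1)\to X(2)$); - $S^3$: $X(1)=\epsilon(1)$, $X(2)=\epsilon(2)$ (independence model; $w$ is fixed to $0$ and the only free parameters are $(\tau_1^2,\tau_2^2)\in(0,\infty)^2$). $f(x\mid S,\theta)$ denotes the Lebesgue density of $P_{S,\theta}$. Prior and posterior. The prior on structures is uniform, $\pi(S^j)=1/3$.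 Given $S$, the parameter has a prior probability density $\pi(\theta\mid S)$ on its parameter space ($\Theta$ for $S^1,S^2$; for $S^3$ a density on the variances $(\tau_1^2,\tau_2^2)\in(0,\infty)^2$). With $\mathcal{D}_{\mathrm{obs}}=(X_i)_{1\le i\le n}$ and $f(\mathcal{D}_{\mathrm{obs}}\mid S,\theta)=\prod_{i=1}^n f(X_i\mid S,\theta)$, $$\pi(S\mid\mathcal{D}_{\mathrm{obs}})=\frac{\int f(\mathcal{D}_{\mathrm{obs}}\mid S,\theta)\pi(\theta\mid S)\,d\theta}{\sum_{j=1}^3\int f(\mathcal{D}_{\mathrm{obs}}\mid S^j,\theta)\pi(\theta\mid S^j)\,d\theta},$$ each integral being over the parameter space of the corresponding structure.
   Formalization: The formal theorem additionally assumes that the prior density of the independence model S^3 is positive at the true variances; without this the claim fails, e.g. if that prior vanishes near the truth while the S^1 prior is positive there. *)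

(* Defs.v *)
From HB Require Import structures.
From mathcomp Require Import all_boot all_order all_algebra.
From mathcomp Require Import finmap.
From mathcomp Require Import all_classical all_reals all_analysis.
From mathcomp Require Import measurable_realfun.

Set Implicit Arguments.
Unset Strict Implicit.
Unset Printing Implicit Defensive.

Import Order.TTheory GRing.Theory Num.Theory.
Import numFieldNormedType.Exports.

Local Open Scope classical_set_scope.
Local Open Scope ring_scope.

(* Parameters are written [theta = (w, (tau_1^2, tau_2^2))]; the second and
   third components are variances, not standard deviations. *)
Definition variance_space {R : realType} : set (R * R) :=
  [set t | 0 < t.1 /\ 0 < t.2].

Definition param_space {R : realType} : set (R * (R * R)) :=
  [set theta | variance_space theta.2].

Lemma product_sigma_finite d1 d2 (T1 : measurableType d1)
    (T2 : measurableType d2) (R : realType)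
    (m1 : {sigma_finite_measure set T1 -> \bar R})
    (m2 : {sigma_finite_measure set T2 -> \bar R}) :
  sigma_finite setT (m1 \x m2)%E.
Proof.
have /sigma_finiteP[F [TF ndF Foo]] := sigma_finiteT m1.
have /sigma_finiteP[G [TG ndG Goo]] := sigma_finiteT m2.
exists (fun n => F n `*` G n).
  rewrite -setXTT TF TG predeqE => -[x y]; split.
    move=> [/= [n _ Fnx] [k _ Gky]]; exists (maxn n k) => //; split.
    - by move: x Fnx; exact/subsetPset/ndF/leq_maxl.
    - by move: y Gky; exact/subsetPset/ndG/leq_maxr.
  by move=> [n _ []/= ? ?]; split; exists n.
move=> k; have [? ?] := Foo k; have [? ?] := Goo k.
split; first exact: measurableX.
by rewrite product_measure1E// lte_mul_pinfty// ge0_fin_numE.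
Qed.

(* [lebesgue_measure] lives on [measurableTypeR R], a copy of [R] with the same
   measurable sets; hence so do the two product measures below. *)
Definition lebesgue2 {R : realType} :=
  (@lebesgue_measure R \x @lebesgue_measure R)%E.

HB.instance Definition _ (R : realType) := Measure.on (@lebesgue2 R).
HB.instance Definition _ (R : realType) :=
  @Measure_isSigmaFinite.Build _ _ _ (@lebesgue2 R)
    (product_sigma_finite (@lebesgue_measure R) (@lebesgue_measure R)).

Definition lebesgue3 {R : realType} :=
  (@lebesgue_measure R \x @lebesgue2 R)%E.

HB.instance Definition _ (R : realType) := Measure.on (@lebesgue3 R).
HB.instance Definition _ (R : realType) :=
  @Measure_isSigmaFinite.Build _ _ _ (@lebesgue3 R)
    (product_sigma_finite (@lebesgue_measure R) (@lebesgue2 R)).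

Inductive structure : Set := S1 | S2 | S3.

(* [sem S w eps] solves the structural equations of [S] for the noise [eps]. *)
Definition sem (R : realType) (S : structure) (w : R) (eps : R * R) : R * R :=
  match S with
  | S1 => (w * eps.2 + eps.1, eps.2)
  | S2 => (eps.1, w * eps.1 + eps.2)
  | S3 => eps
  end.

Definition noise_law (R : realType) (t : R * R) : set (R * R) -> \bar R :=
  (normal_prob 0%R (Num.sqrt t.1) \x normal_prob 0%R (Num.sqrt t.2))%E.

Definition model_law (R : realType) (S : structure) (theta : R * (R * R)) :
  set (R * R) -> \bar R := pushforward (noise_law theta.2) (sem S theta.1).

Definition model_density (R : realType) (S : structure) (theta : R * (R * R))
    (x : R * R) : R :=
  let: (w, (t1, t2)) := theta in
  match S with
  | S1 => normal_pdf (w * x.2) (Num.sqrt t1) x.1 * normal_pdf 0 (Num.sqrt t2) x.2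
  | S2 => normal_pdf 0 (Num.sqrt t1) x.1 * normal_pdf (w * x.1) (Num.sqrt t2) x.2
  | S3 => normal_pdf 0 (Num.sqrt t1) x.1 * normal_pdf 0 (Num.sqrt t2) x.2
  end.

Section ModelDensity.
Variable R : realType.
Local Notation mR := (measurableTypeR R).
Local Notation leb := (@lebesgue_measure R).

Lemma lebesgue_measure_shift (c : R) (A : set R) : measurable A ->
  pushforward leb ((fun y => c + y) : _ -> mR) A = leb A.
Proof.
have mc : measurable_fun [set: mR] ((fun y => c + y) : _ -> mR).
  by apply: measurable_funD.
move=> mA; apply/esym/lebesgue_measure_unique => //= _ [[a b]] _ <-.
rewrite /pushforward.
have -> : (fun y : R => c + y) @^-1` `]a, b]%classic = `]a - c, b - c]%classic.
  by apply/seteqP; split => y /=; rewrite !in_itv/= ltrBlDl lerBrDl.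
rewrite !lebesgue_measure_itv/= !lte_fin ltrD2r; case: ifPn => // _.
by rewrite -!EFinB opprB addrA subrK.
Qed.

Lemma normal_prob_shift (c s : R) (A : set R) : measurable A -> s != 0 ->
  normal_prob 0 s ((fun y => c + y) @^-1` A) =
  (\int[leb]_(y in A) (normal_pdf c s y)%:E)%E.
Proof.
move=> mA s0.
have mc : measurable_fun [set: mR] ((fun y => c + y) : _ -> mR).
  by apply: measurable_funD.
transitivity (\int[pushforward leb ((fun y => c + y)%R : _ -> mR)]_(y in A)
    (normal_pdf c s y)%:E)%E; last first.
  by apply: eq_measure_integral => //= B mB _; exact: lebesgue_measure_shift.
rewrite ge0_integral_pushforward//=; last 2 first.
- by apply/measurable_EFinP/measurable_funTS; exact: measurable_normal_pdf.
- by move=> y _; rewrite lee_fin normal_pdf_ge0.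
rewrite /normal_prob; apply: eq_integral => y _ /=.
by rewrite !normal_pdfE//= /normal_fun subr0 addrC addKr.
Qed.

Lemma integral_normal_prob (s : R) (f : R -> \bar R) : s != 0 ->
  measurable_fun setT f -> (forall x, 0 <= f x <= 1)%E ->
  (\int[normal_prob 0%R s]_x f x = \int[leb]_x (f x * (normal_pdf 0 s x)%:E))%E.
Proof.
move=> s0 mf f01.
have dom : normal_prob 0 s `<< leb by exact: normal_prob_dominates.
rewrite -(Radon_Nikodym_change_of_variables dom)//=; last first.
  apply/integrableP; split => //.
  apply: (@le_lt_trans _ _ (\int[normal_prob 0%R s]_x cst 1 x)%E).
    apply: ge0_le_integral => //=.
      exact: measurableT_comp.
    by move=> x _; have /andP[f0 f1] := f01 x; rewrite gee0_abs.
  by rewrite integral_cst// mul1e [X in (X < _)%E]probability_setT ltry.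
apply: ae_eq_integral => //.
- exact: emeasurable_funM.
- have mp : measurable_fun [set: mR] (fun x : mR => (normal_pdf 0 s x)%:E).
    by apply/measurable_EFinP; exact: measurable_normal_pdf.
  exact: emeasurable_funM.
- set h0 := Radon_Nikodym _ _.
  have : ae_eq leb setT h0 (fun x => (normal_pdf 0 s x)%:E); last first.
    by apply: filterS => x /= hx xT; rewrite hx.
  rewrite /h0 Radon_NikodymE//=.
  case: cid => /= h [h1 h2 h3].
  apply: integral_ae_eq => //=.
  + by apply/measurableT_comp => //; exact: measurable_normal_pdf.
  + by move=> E E01 mE; rewrite -h3.
Qed.

Lemma normal_prodE (s1 s2 : R) (B : set (R * R)) : measurable B ->
  (normal_prob 0%R s1 \x normal_prob 0%R s2)%E B =
  (normal_prob 0%R s1 \x^ normal_prob 0%R s2)%E B.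
Proof.
move=> mB; apply: product_measure_unique => // C D mC mD.
exact: product_measure2E.
Qed.

Lemma measurable_shift_pdf1 (w s : R) : s != 0 ->
  measurable_fun setT (fun x : R * R => normal_pdf (w * x.2) s x.1).
Proof.
move=> s0; rewrite (_ : (fun _ => _) =
    normal_pdf 0 s \o (fun x : R * R => x.1 - w * x.2)); last first.
  by apply/funext => x /=; rewrite !normal_pdfE//= /normal_fun subr0.
apply: measurableT_comp; first exact: measurable_normal_pdf.
by apply: measurable_funB => //; apply: measurable_funM.
Qed.

Lemma measurable_shift_pdf2 (w s : R) : s != 0 ->
  measurable_fun setT (fun x : R * R => normal_pdf (w * x.1) s x.2).
Proof.
move=> s0; rewrite (_ : (fun _ => _) =
    normal_pdf 0 s \o (fun x : R * R => x.2 - w * x.1)); last first.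
  by apply/funext => x /=; rewrite !normal_pdfE//= /normal_fun subr0.
apply: measurableT_comp; first exact: measurable_normal_pdf.
by apply: measurable_funB => //; apply: measurable_funM.
Qed.

Lemma sem1_law (w s1 s2 : R) (A : set (R * R)) : s1 != 0 -> s2 != 0 ->
  measurable A ->
  (normal_prob 0%R s1 \x normal_prob 0%R s2)%E (sem S1 w @^-1` A) =
  (\int[lebesgue2]_(x in A)
     (normal_pdf (w * x.2) s1 x.1 * normal_pdf 0 s2 x.2)%:E)%E.
Proof.
move=> s10 s20 mA.
have msem : measurable_fun setT (sem S1 w : R * R -> R * R).
  apply: measurable_fun_pair => //=.
  by apply: measurable_funD => //; apply: measurable_funM.
have mB : measurable (sem S1 w @^-1` A).
  by rewrite -[X in measurable X]setTI; exact: msem.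
rewrite normal_prodE// /product_measure2.
rewrite integral_normal_prob//=; last 2 first.
- exact: (measurable_fun_ysection (normal_prob 0 s1)).
- by move=> x; rewrite measure_ge0 probability_le1//; exact: measurable_ysection.
rewrite [RHS]integral_mkcond.
rewrite (fubini_tonelli2 (m1 := @lebesgue_measure R)
  (m2 := @lebesgue_measure R))/=; last 2 first.
- apply: (measurable_restrictT _ mA).1; apply/measurable_EFinP/measurable_funTS.
  apply: measurable_funM; first exact: measurable_shift_pdf1.
  by apply: measurableT_comp => //; exact: measurable_normal_pdf.
- by apply: erestrict_ge0 => x _; rewrite lee_fin mulr_ge0// normal_pdf_ge0.
apply: eq_integral => y _; rewrite /fubini_G.
rewrite (_ : ysection _ y = (fun e => w * y + e) @^-1` ysection A y); last first.
  by apply/seteqP; split => e /=; rewrite /ysection/= !inE.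
rewrite normal_prob_shift//; last exact: measurable_ysection.
rewrite -ge0_integralZr//=; last 4 first.
- exact: measurable_ysection.
- by apply/measurable_EFinP/measurable_funTS; exact: measurable_normal_pdf.
- by move=> x _; rewrite lee_fin normal_pdf_ge0.
- by rewrite lee_fin normal_pdf_ge0.
rewrite integral_mkcond; apply: eq_integral => x _.
by rewrite !patchE mem_ysection EFinM.
Qed.
Lemma sem2_law (w s1 s2 : R) (A : set (R * R)) : s1 != 0 -> s2 != 0 ->
  measurable A ->
  (normal_prob 0%R s1 \x normal_prob 0%R s2)%E (sem S2 w @^-1` A) =
  (\int[lebesgue2]_(x in A)
     (normal_pdf 0 s1 x.1 * normal_pdf (w * x.1) s2 x.2)%:E)%E.
Proof.
move=> s10 s20 mA.
have msem : measurable_fun setT (sem S2 w : R * R -> R * R).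
  apply: measurable_fun_pair => //=.
  by apply: measurable_funD => //; apply: measurable_funM.
have mB : measurable (sem S2 w @^-1` A).
  by rewrite -[X in measurable X]setTI; exact: msem.
rewrite /product_measure1.
rewrite integral_normal_prob//=; last 2 first.
- exact: (measurable_fun_xsection (normal_prob 0 s2)).
- by move=> x; rewrite measure_ge0 probability_le1//; exact: measurable_xsection.
rewrite [RHS]integral_mkcond.
rewrite (fubini_tonelli1 (m1 := @lebesgue_measure R)
  (m2 := @lebesgue_measure R))/=; last 2 first.
- apply: (measurable_restrictT _ mA).1; apply/measurable_EFinP/measurable_funTS.
  apply: measurable_funM; last first.
    exact: measurable_shift_pdf2.
  by apply: measurableT_comp => //; exact: measurable_normal_pdf.
- by apply: erestrict_ge0 => x _; rewrite lee_fin mulr_ge0// normal_pdf_ge0.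
apply: eq_integral => x _; rewrite /fubini_F.
rewrite (_ : xsection _ x = (fun e => w * x + e) @^-1` xsection A x); last first.
  by apply/seteqP; split => e /=; rewrite /xsection/= !inE.
rewrite normal_prob_shift//; last exact: measurable_xsection.
rewrite -ge0_integralZr//=; last 4 first.
- exact: measurable_xsection.
- by apply/measurable_EFinP/measurable_funTS; exact: measurable_normal_pdf.
- by move=> y _; rewrite lee_fin normal_pdf_ge0.
- by rewrite lee_fin normal_pdf_ge0.
rewrite integral_mkcond; apply: eq_integral => y _.
by rewrite !patchE mem_xsection EFinM muleC.
Qed.

(* [model_density S theta] is the Lebesgue density of [model_law S theta]. *)
Lemma model_density_law (S : structure) (theta : R * (R * R))
    (A : set (R * R)) : param_space theta -> measurable A ->
  model_law S theta A =
    (\int[lebesgue2]_(x in A) (model_density S theta x)%:E)%E.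
Proof.
case: theta => w [t1 t2] [/= t1_gt0 t2_gt0] mA.
have s1 : Num.sqrt t1 != 0 by rewrite sqrtr_eq0 -ltNge.
have s2 : Num.sqrt t2 != 0 by rewrite sqrtr_eq0 -ltNge.
case: S; [exact: sem1_law|exact: sem2_law|].
rewrite (_ : model_law _ _ _ = (normal_prob 0%R (Num.sqrt t1) \x
    normal_prob 0%R (Num.sqrt t2))%E (sem S1 0 @^-1` A)); last first.
  rewrite /model_law /pushforward; congr (_ _).
  by apply/seteqP; split => -[x y] /=; rewrite mul0r add0r.
rewrite sem1_law//; apply: eq_integral => x _.
by rewrite mul0r.
Qed.
End ModelDensity.

Definition likelihood (R : realType) (n : nat) (x : nat -> R * R)
    (S : structure) (theta : R * (R * R)) : R :=
  \prod_(i < n) model_density S theta (x i).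

Definition is_prob_density d (U : measurableType d) (R : realType)
    (mu : {measure set U -> \bar R}) (D : set U) (p : U -> R) : Prop :=
  [/\ measurable_fun D p, forall u, D u -> 0 <= p u
    & (\int[mu]_(u in D) (p u)%:E = 1)%E].

(* On an open set of a finite-dimensional space, [f] is [k + 1] times Frechet
   differentiable iff it is differentiable and every directional derivative
   is [k] times differentiable. *)
Fixpoint times_differentiable (R : realType) (V : normedModType R) (k : nat)
    (D : set V) (f : V -> R) : Prop :=
  if k is k'.+1 then
    (forall x, D x -> differentiable f x) /\
    (forall v, times_differentiable k' D ('D_v f))
  else True.

Section Posterior.
Context (R : realType) (pi1 pi2 : R * (R * R) -> R) (pi3 : R * R -> R).

(* [\int[_]_(_ in _) _] is the real-valued integral, which is [0] if the
   underlying extended-real integral is infinite. *)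
Definition evidence (n : nat) (x : nat -> R * R) (S : structure) : R :=
  match S with
  | S1 => \int[lebesgue3]_(theta in param_space)
            (likelihood n x S1 theta * pi1 theta)
  | S2 => \int[lebesgue3]_(theta in param_space)
            (likelihood n x S2 theta * pi2 theta)
  | S3 => \int[lebesgue2]_(t in variance_space)
            (likelihood n x S3 (0, t) * pi3 t)
  end.

Definition posterior (n : nat) (x : nat -> R * R) (S : structure) : R :=
  evidence n x S / \sum_(S' <- [:: S1; S2; S3]) evidence n x S'.
End Posterior.

Section Probability.
Context d (T : measurableType d) (R : realType) (P : probability T R).

Definition mutually_independent d' (U : measurableType d')
    (X : nat -> {RV P >-> U}) : Prop :=
  forall (J : {fset nat}) (A : nat -> set U), (forall i, measurable (A i)) ->
    P (\bigcap_(i in [set` J]) (X i @^-1` A i)) =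
    (\prod_(i <- J) P (X i @^-1` A i))%E.

Definition has_law d' (U : measurableType d') (X : {RV P >-> U})
    (mu : set U -> \bar R) : Prop :=
  forall A, measurable A -> distribution P X A = mu A.

Definition bounded_in_probability (Y : nat -> T -> R) : Prop :=
  forall e : R, 0 < e -> exists M : R,
    \forall n \near \oo, (P [set t | (M < `|Y n t|)%R] <= e%:E)%E.
End Probability.

(* Main.v *)
Require Import Defs.
From HB Require Import structures.
From mathcomp Require Import all_boot all_order all_algebra.
From mathcomp Require Import finmap.
From mathcomp Require Import all_classical all_reals all_analysis.
From mathcomp Require Import measurable_realfun ring lra.

Import Order.TTheory GRing.Theory Num.Theory.
Import numFieldNormedType.Exports.

Local Open Scope classical_set_scope.
Local Open Scope ring_scope.

(** Write [a], [b], [c] for the empirical means of [X(1)^2], [X(2)^2] and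
    [X(1)X(2)].  For each structure the likelihood is [exp (- n/2 * D)], where
    [D], minus twice the mean log-likelihood, depends on the data only through
    [a], [b], [c] ([likelihoodE]).  Completing the square in [w] and profiling
    the two variances ([deviance_split]) gives, for the edge [X(2) -> X(1)],

      [D(w,u,v) = D0 + ln (a'/a) + h(u,a') + h(v,b) + b (w - c/b)^2 / u],

    with [a' = a - c^2/b] and [h(u,a) = ln (u/a) + a/u - 1 >= 0], where [D0] is
    the minimum of the deviance of the independence model.  The edge
    [X(1) -> X(2)] is the same with the two coordinates exchanged.

    The three evidences share the factor [exp (- n/2 * D0)].  Suppose that [a]
    and [b] are close to the true variances and that [n c^2 <= K], so that the
    term [ln (a'/a)] costs at most a constant factor.  Then

    - the evidence of an edge structure is [O(n^(-3/2))] times that factor: on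
      a small box around the true parameter the prior density is bounded, being
      continuous there, and [D - D0 - ln (a'/a)] dominates a quadratic form in
      three variables, so that a Gaussian integral bounds the contribution of
      the box; outside the box [D - D0 - ln (a'/a)] is bounded below by a
      positive constant, and the total prior mass is one ([deviance_gap],
      [edge_evidence_le]);
    - the evidence of independence is at least a constant times [1/n] times
      that factor: the prior density is bounded below near the truth, and
      [n (D - D0)] is bounded on a square of side [n^(-1/2)]
      ([independence_evidence_ge]).

    The quotient is [O(n^(-1/2))] ([posterior_bound]).

    The event in question has probability as close to one as desired:
    [X(1)^2 - tau_1^2], [X(2)^2 - tau_2^2] and [X(1)X(2)] are centered and
    square integrable, so that Chebyshev's inequality applies to their sums
    ([sq1_chebyshev], [sq2_chebyshev], [cross_chebyshev]).  The mean and the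
    variance of the normal law are obtained without integrating by parts: the
    likelihood ratio of two normal laws has integral one, and comparing it with
    its logarithm gives an inequality that determines both moments
    ([normal_moments]).  The measurability of the posterior as a function of
    the data ([measurable_posterior]) allows the exceptional event to be
    compared with the three Chebyshev events. *)

(** * Elementary bounds on the Gaussian variance profile *)

Lemma ln_le_sub1 {R : realType} (z : R) : 0 < z -> ln z <= z - 1.
Proof.
by move=> z0; rewrite -{1}(subrK 1 z) addrC; apply: le_ln1Dx; rewrite ltrBrDl subrr.
Qed.

(** The profile [h] of the Gaussian variance: half of [excess u a] is the
    relative entropy of the centered normal law with variance [a] with respect
    to the one with variance [u]. *)
Definition excess {R : realType} (u a : R) : R := ln u - ln a + a / u - 1.

(** With [s = sqrt (a/u)], bounding [ln (a/u) = 2 ln s] by [2 (s - 1)] leaves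
    the square [(s - 1)^2]. The normalisation by [u + a] keeps the bound
    useful both near [u = a] and as [u] tends to [0] or to infinity. *)
Lemma excess_ge {R : realType} (u a : R) : 0 < u -> 0 < a ->
  ((u - a) / (u + a)) ^+ 2 / 2 <= excess u a.
Proof.
move=> u0 a0; rewrite /excess.
pose s := Num.sqrt (a / u).
have s0 : 0 < s by rewrite sqrtr_gt0 divr_gt0.
have sE : a / u = s ^+ 2 by rewrite sqr_sqrtr// divr_ge0// ltW.
have aE : a = s ^+ 2 * u by rewrite -sE mulfVK// gt_eqF.
have lnE : ln u - ln a = - (2 * ln s).
  by rewrite -ln_div// ?posrE// -[u / a]invf_div lnV ?posrE ?divr_gt0// sE lnXn// mulr_natl.
have lns := ln_le_sub1 s s0.
have ratio : (u - a) / (u + a) = (1 - s ^+ 2) / (1 + s ^+ 2).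
  rewrite aE; field; apply/andP; split; apply/lt0r_neq0; nra.
have bnd : ((1 - s ^+ 2) / (1 + s ^+ 2)) ^+ 2 / 2 <= (s - 1) ^+ 2.
  rewrite expr_div_n -mulrA -invfM ler_pdivrMr; last by nra.
  have : 0 <= (s - 1) ^+ 2 by exact: sqr_ge0.
  have : 0 <= (s - 1) ^+ 2 * (s - 1) ^+ 2 by apply: mulr_ge0; exact: sqr_ge0.
  have : 0 <= (s - 1) ^+ 2 * (s ^+ 4 + 1) by apply: mulr_ge0; [exact: sqr_ge0|nra].
  have : 0 <= (s - 1) ^+ 2 * s ^+ 2 by apply: mulr_ge0; exact: sqr_ge0.
  nra.
rewrite ratio lnE sE; nra.
Qed.

Lemma excess_ge0 {R : realType} (u a : R) : 0 < u -> 0 < a -> 0 <= excess u a.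
Proof.
move=> u0 a0; apply: le_trans (excess_ge _ _ u0 a0).
by rewrite divr_ge0// sqr_ge0.
Qed.

Lemma excess_le {R : realType} (u a : R) : 0 < u -> 0 < a ->
  excess u a <= (u - a) ^+ 2 / (u * a).
Proof.
move=> u0 a0; rewrite /excess.
have : ln u - ln a <= u / a - 1.
  by rewrite -ln_div ?posrE//; apply: ln_le_sub1; exact: divr_gt0.
have -> : (u - a) ^+ 2 / (u * a) = u / a + a / u - 2.
  by field; rewrite !gt_eqF.
lra.
Qed.

(** Near the true variance [t] the lower bound is quadratic, and away from it
    a positive constant, with one [k] for all empirical variances [a] close to
    [t]. *)
Lemma excess_gap {R : realType} (t del : R) : 0 < t -> 0 < del -> del <= t / 2 ->
  exists2 k, 0 < k & forall u a, 0 < u -> `|a - t| <= del / 2 ->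
    (`|u - t| < del -> k * (u - a) ^+ 2 <= excess u a) /\
    (del <= `|u - t| -> k <= excess u a).
Proof.
move=> t0 d0 dt.
exists (Num.min (1 / (32 * t ^+ 2)) (del ^+ 2 / (200 * t ^+ 2))).
  by rewrite lt_min !divr_gt0//; nra.
move=> u a u0; rewrite ler_norml => /andP[a1 a2].
have a0 : 0 < a by lra.
have gap := excess_ge _ _ u0 a0.
have ua : 0 < u + a by lra.
split=> hu.
- move: hu; rewrite ltr_norml => /andP[u1 u2].
  apply: le_trans gap; apply: (@le_trans _ _ (1 / (32 * t ^+ 2) * (u - a) ^+ 2)).
    by rewrite ler_wpM2r ?sqr_ge0// ge_min lexx.
  rewrite expr_div_n mul1r [leLHS]mulrC -[leRHS]mulrA. rewrite -invfM ler_wpM2l ?sqr_ge0//.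
  rewrite lef_pV2 ?posrE; nra.
- apply: le_trans gap; apply: (@le_trans _ _ (del ^+ 2 / (200 * t ^+ 2))).
    by rewrite ge_min lexx orbT.
  have -> : del ^+ 2 / (200 * t ^+ 2) = (del / (10 * t)) ^+ 2 / 2.
    by field; rewrite gt_eqF.
  rewrite ler_pM2r ?invr_gt0// -[leRHS]real_normK ?num_real// ler_sqr ?nnegrE//; last first.
    by rewrite divr_ge0//; lra.
  rewrite normrM normfV (gtr0_norm ua) ler_pdivrMr; last by lra.
  rewrite mulrAC ler_pdivlMr//.
  have : del / 2 <= `|u - a|.
    have := ler_distD a u t.
    have : `|a - t| <= del / 2 by rewrite ler_norml; apply/andP.
    lra.
  case: (leP a u) => au.
    rewrite ger0_norm ?subr_ge0//; nra.
  rewrite ltr0_norm ?subr_lt0//; nra.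
Qed.

(** Minus twice the mean log-likelihood of the edge [X(2) -> X(1)] with
    coefficient [w] and noise variances [u], [v], for the empirical means [a],
    [b], [c] of [X(1)^2], [X(2)^2], [X(1)X(2)]. *)
Definition deviance {R : realType} (a b c w u v : R) : R :=
  2 * ln (2 * pi) + ln u + ln v + (a - 2 * w * c + w ^+ 2 * b) / u + b / v.

(** Completing the square in [w] leaves the residual variance [a - c^2/b] of
    the regression of [X(1)] on [X(2)] in the place of [a]. *)
Lemma deviance_split {R : realType} (a b c w u v : R) :
  0 < a -> 0 < b -> 0 < u -> 0 < v ->
  deviance a b c w u v = deviance a b 0 0 a b
    + (ln (a - c ^+ 2 / b) - ln a)
    + (excess u (a - c ^+ 2 / b) + excess v b + b * (w - c / b) ^+ 2 / u).
Proof.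
move=> a0 b0 u0 v0; rewrite /deviance /excess.
by field; rewrite !gt_eqF.
Qed.

(** Adding an edge improves the maximal fit by [ln a - ln (a - c^2/b)], which
    is of the order of [c^2]; after multiplication by [n/2] it stays bounded
    as long as [n c^2] does. *)
Lemma ln_shrink {R : realType} (t1 t2 a b c : R) : 0 < t1 -> 0 < t2 ->
  t2 / 2 <= b -> t1 / 2 <= a - c ^+ 2 / b ->
  - (4 / (t1 * t2) * c ^+ 2) <= ln (a - c ^+ 2 / b) - ln a.
Proof.
move=> t10 t20 bt; have b0 : 0 < b by lra.
have cb0 : 0 <= c ^+ 2 / b by rewrite divr_ge0 ?sqr_ge0// ltW.
move aE : (a - c ^+ 2 / b) => a' at1.
have a'0 : 0 < a' by lra.
have a0 : 0 < a by lra.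
have := ln_le_sub1 _ (divr_gt0 a0 a'0); rewrite ln_div ?posrE//.
suff : a / a' - 1 <= 4 / (t1 * t2) * c ^+ 2 by lra.
have -> : a / a' - 1 = c ^+ 2 * (b * a')^-1.
  have -> : a = a' + c ^+ 2 / b by rewrite -aE subrK.
  by field; rewrite !gt_eqF.
rewrite [leRHS]mulrC ler_wpM2l ?sqr_ge0// -[4]invrK -invfM.
have tt0 := mulr_gt0 t10 t20.
have ba : t1 / 2 * (t2 / 2) <= b * a'.
  by rewrite mulrC; apply: ler_pM => //; rewrite divr_ge0 ?ltW.
by rewrite lef_pV2 ?posrE; lra.
Qed.

Definition box {R : realType} (del m1 m2 w u v : R) : bool :=
  [&& `|w| < del, `|u - m1| < del & `|v - m2| < del].

(** The Laplace-type lower bound for the edge [X(2) -> X(1)]. The box is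
    centered at the true parameter, which does not depend on the data; the
    quadratic form is centered at the maximum likelihood estimator, where
    Gaussian integration takes place. *)
Lemma deviance_gap {R : realType} (t1 t2 del : R) :
  0 < t1 -> 0 < t2 -> 0 < del -> del <= t1 / 2 -> del <= t2 / 2 ->
  exists2 k, 0 < k & forall a b c w u v, 0 < u -> 0 < v ->
    `|a - t1| <= del / 4 -> `|b - t2| <= del / 4 ->
    c ^+ 2 / b <= del / 4 -> `|c / b| <= del / 2 ->
    deviance a b 0 0 a b - 4 / (t1 * t2) * c ^+ 2 +
      k * (if box del t1 t2 w u v then
             (w - c / b) ^+ 2 + (u - (a - c ^+ 2 / b)) ^+ 2 + (v - b) ^+ 2
           else 1) <= deviance a b c w u v.
Proof.
move=> t10 t20 d0 dt1 dt2.
have [k1 k10 gap1] := excess_gap _ _ t10 d0 dt1.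
have [k2 k20 gap2] := excess_gap _ _ t20 d0 dt2.
(* [k3] bounds [b / u] below on the box; [k4] is [k3 * (del / 2)^2], the value
   of the quadratic term in [w] when [w] leaves the box while [u] stays in it.
   *)
pose k3 := t2 / (4 * t1); pose k4 := t2 * del ^+ 2 / (16 * t1).
have k30 : 0 < k3 by rewrite divr_gt0//; lra.
have k40 : 0 < k4 by rewrite divr_gt0//; [exact/mulr_gt0/exprn_gt0|lra].
pose k := Num.min (Num.min k1 k2) (Num.min k3 k4).
have kk1 : k <= k1 by rewrite !ge_min lexx.
have kk2 : k <= k2 by rewrite !ge_min lexx orbT.
have kk3 : k <= k3 by rewrite !ge_min lexx !orbT.
have kk4 : k <= k4 by rewrite !ge_min lexx !orbT.
have k0 : 0 < k by rewrite !lt_min k10 k20 k30 k40.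
clearbody k.
exists k => // a b c w u v u0 v0 ha hb hc hm.
have /andP[a1 a2] : - (del / 4) <= a - t1 <= del / 4 by rewrite -ler_norml.
have /andP[b1 b2] : - (del / 4) <= b - t2 <= del / 4 by rewrite -ler_norml.
have a0 : 0 < a by lra.
have b0 : 0 < b by lra.
rewrite (deviance_split a b c w)//.
have cb0 : 0 <= c ^+ 2 / b by rewrite divr_ge0 ?sqr_ge0// ltW.
set a' := a - c ^+ 2 / b; set m := c / b.
have a'0 : t1 / 2 <= a' by rewrite /a'; lra.
have bt2 : t2 / 2 <= b by lra.
have ha' : `|a' - t1| <= del / 2 by rewrite ler_norml /a'; apply/andP; split; lra.
have hb' : `|b - t2| <= del / 2 by apply: le_trans hb _; lra.
have [g1 g1'] := gap1 u a' u0 ha'.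
have [g2 g2'] := gap2 v b v0 hb'.
clear gap1 gap2.
have e1 : 0 <= excess u a' by apply: excess_ge0 => //; lra.
have e2 : 0 <= excess v b by exact: excess_ge0.
have e3 : 0 <= b * (w - m) ^+ 2 / u.
  by rewrite divr_ge0 ?(ltW u0)// mulr_ge0 ?sqr_ge0// ltW.
have lna := ln_shrink _ _ _ _ _ t10 t20 bt2 a'0.
suff : k * (if box del t1 t2 w u v then
             (w - m) ^+ 2 + (u - a') ^+ 2 + (v - b) ^+ 2 else 1) <=
       excess u a' + excess v b + b * (w - m) ^+ 2 / u by lra.
have wlow x : u < 2 * t1 -> x <= (w - m) ^+ 2 -> k3 * x <= b * (w - m) ^+ 2 / u.
  move=> u2 hx; apply: (@le_trans _ _ (k3 * (w - m) ^+ 2)).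
    by rewrite ler_pM2l.
  rewrite ler_pdivlMr// mulrAC ler_wpM2r ?sqr_ge0//.
  have -> : k3 * u = t2 * (u / (4 * t1)) by rewrite /k3; field; rewrite gt_eqF.
  have : t2 * (u / (4 * t1)) <= t2 * (1 / 2).
    by rewrite ler_pM2l// ler_pdivrMr; lra.
  lra.
rewrite /box; case: ifPn.
- case/and3P => hw hu hv.
  have /andP[u1 u2] : - del < u - t1 < del by rewrite -ltr_norml.
  have := wlow _ _ (lexx ((w - m) ^+ 2)).
  have := g1 hu; have := g2 hv.
  have := ler_wpM2r (sqr_ge0 (w - m)) kk3.
  have := ler_wpM2r (sqr_ge0 (u - a')) kk1.
  have := ler_wpM2r (sqr_ge0 (v - b)) kk2.
  have : u < 2 * t1 by lra.
  lra.
- rewrite mulr1 !negb_and -!leNgt.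
  case: (leP del `|u - t1|) => [hu _|hu /=]; first by have := g1' hu; lra.
  case/orP => [hw|hv]; last by have := g2' hv; lra.
  have /andP[u1 u2] : - del < u - t1 < del by rewrite -ltr_norml.
  have dw : (del / 2) ^+ 2 <= (w - m) ^+ 2.
    rewrite -[leRHS]real_normK ?num_real// ler_sqr ?nnegrE//; last by lra.
    have := ler_distD m w 0; rewrite !subr0; lra.
  have u3 : u < 2 * t1 by lra.
  have := wlow _ u3 dw.
  have -> : k3 * (del / 2) ^+ 2 = k4 by rewrite /k3 /k4; field; rewrite gt_eqF.
  lra.
Qed.

(** Turns the smallness of [c^2] into the two conditions on [c] that
    [deviance_gap] requires. *)
Lemma small_cross {R : realType} (t del : R) : 0 < t -> 0 < del -> del <= t / 2 ->
  exists2 eta, 0 < eta & forall b c, `|b - t| <= del / 4 -> c ^+ 2 <= eta ->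
    c ^+ 2 / b <= del / 4 /\ `|c / b| <= del / 2.
Proof.
move=> t0 d0 dt; exists (Num.min (del * t / 8) ((del * t / 4) ^+ 2)).
  by rewrite lt_min exprn_gt0 divr_gt0// mulr_gt0.
move=> b c; rewrite ler_norml => /andP[b1 b2]; rewrite le_min => /andP[c1 c2].
have b0 : 0 < b by lra.
split; first by rewrite ler_pdivrMr//; nra.
rewrite normrM normfV (gtr0_norm b0) ler_pdivrMr//.
move: c2; rewrite -[c ^+ 2]real_normK ?num_real// ler_sqr ?nnegrE//; last first.
  by rewrite divr_ge0// mulr_ge0// ltW.
move=> c2; apply: (le_trans c2); nra.
Qed.

(** * The likelihood as a function of three empirical means *)

Lemma normal_pdf_sqrtE {R : realType} (m u x : R) : 0 < u ->
  normal_pdf m (Num.sqrt u) x =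
  expR (- (1 / 2) * (ln (2 * pi) + ln u + (x - m) ^+ 2 / u)).
Proof.
move=> u0.
have su0 : Num.sqrt u != 0 by rewrite sqrtr_eq0 -ltNge.
rewrite normal_pdfE// /normal_peak /normal_fun sqr_sqrtr ?(ltW u0)//.
have p0 : 0 < u * pi *+ 2 by rewrite mulrn_wgt0// mulr_gt0// pi_gt0.
have -> : (Num.sqrt (u * pi *+ 2))^-1 = expR (- (1 / 2) * (ln (2 * pi) + ln u)).
  rewrite -lnM ?posrE ?mulr_gt0 ?pi_gt0//.
  have -> : 2 * pi * u = u * pi *+ 2 by rewrite -mulr_natl; ring.
  have sp : 0 < Num.sqrt (u * pi *+ 2) by rewrite sqrtr_gt0.
  rewrite -[LHS]lnK ?posrE ?invr_gt0// lnV ?posrE//; congr expR.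
  by rewrite -{2}(sqr_sqrtr (ltW p0)) lnXn// -mulr_natl; field.
rewrite -expRD; congr expR; rewrite -mulr_natl; field.
by rewrite gt_eqF.
Qed.

Definition mean_of {R : realType} (g : R * R -> R) (n : nat) (x : nat -> R * R) : R :=
  (\sum_(i < n) g (x i)) / n%:R.

Definition sq1 {R : realType} (z : R * R) : R := z.1 ^+ 2.
Definition sq2 {R : realType} (z : R * R) : R := z.2 ^+ 2.
Definition cross {R : realType} (z : R * R) : R := z.1 * z.2.

Lemma sum_mean_of {R : realType} (g : R * R -> R) n (x : nat -> R * R) :
  \sum_(i < n) g (x i) = n%:R * mean_of g n x.
Proof.
rewrite /mean_of; case: n => [|n]; first by rewrite big_ord0 mul0r.
by rewrite mulrC divfK// pnatr_eq0.
Qed.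

Lemma sum_centered {R : realType} (g : R * R -> R) (n : nat) (x : nat -> R * R) (t : R) :
  \sum_(i < n) (g (x i) - t) = n%:R * (mean_of g n x - t).
Proof.
by rewrite sumrB sumr_const card_ord (sum_mean_of g n x) mulrBr -[t *+ n]mulr_natl.
Qed.

(** The edge [X(1) -> X(2)] is the edge [X(2) -> X(1)] with the coordinates
    exchanged, and independence is the case [w = 0]. *)
Definition structure_deviance {R : realType} (S : structure) (a b c : R)
    (theta : R * (R * R)) : R :=
  match S with
  | S1 => deviance a b c theta.1 theta.2.1 theta.2.2
  | S2 => deviance b a c theta.1 theta.2.2 theta.2.1
  | S3 => deviance a b c 0 theta.2.1 theta.2.2
  end.

(** Affineness in the statistics is what makes the deviance of a sample the
    mean of the deviances of its points. *)
Lemma structure_deviance_affine {R : realType} (S : structure)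
    (theta : R * (R * R)) : exists K A B C, forall a b c,
  structure_deviance S a b c theta = K + A * a + B * b + C * c.
Proof.
case: theta => w [u v]; rewrite /structure_deviance /deviance /=; case: S.
- exists (2 * ln (2 * pi) + ln u + ln v), u^-1, (w ^+ 2 / u + v^-1), (- (2 * w / u)).
  by move=> a b c; ring.
- exists (2 * ln (2 * pi) + ln u + ln v), (w ^+ 2 / v + u^-1), v^-1, (- (2 * w / v)).
  by move=> a b c; ring.
- exists (2 * ln (2 * pi) + ln u + ln v), u^-1, v^-1, 0.
  by move=> a b c; ring.
Qed.

Lemma model_densityE {R : realType} (S : structure) (theta : R * (R * R))
    (z : R * R) : param_space theta ->
  model_density S theta z =
  expR (- (1 / 2) * structure_deviance S (sq1 z) (sq2 z) (cross z) theta).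
Proof.
case: theta => w [u v] [/= u0 v0].
rewrite /structure_deviance /deviance /sq1 /sq2 /cross.
by case: S => /=; rewrite !normal_pdf_sqrtE// -expRD; congr expR; field; rewrite !gt_eqF.
Qed.

Lemma likelihoodE {R : realType} (n : nat) (x : nat -> R * R) (S : structure)
    (theta : R * (R * R)) : param_space theta ->
  likelihood n x S theta = expR (- (n%:R / 2) * structure_deviance S
    (mean_of sq1 n x) (mean_of sq2 n x) (mean_of cross n x) theta).
Proof.
move=> htheta; rewrite /likelihood.
under eq_bigr do rewrite model_densityE//.
have [K [A [B [C devE]]]] := structure_deviance_affine S theta.
rewrite -expR_sum -mulr_sumr devE; congr expR.
under eq_bigr do rewrite devE.
rewrite !big_split/= -!mulr_sumr (sum_mean_of sq1 n x) (sum_mean_of sq2 n x)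
  (sum_mean_of cross n x) sumr_const card_ord -mulr_natl.
move: (mean_of _ _ _) (mean_of _ _ _) (mean_of _ _ _) => a b c.
by field.
Qed.

(** * Measurability and Gaussian integrals *)

(** The identity [1/y = y * (y^2)^(-1)], which also holds for [y = 0], reduces
    inversion to a real power of a nonnegative number. *)
Lemma measurable_funV d (T : measurableType d) (R : realType) (f : T -> R) :
  measurable_fun setT f -> measurable_fun setT (fun x => (f x)^-1).
Proof.
move=> mf.
rewrite (_ : (fun _ => _) = (fun x => f x * (f x ^+ 2) `^ (-1))); last first.
  apply/funext => x; rewrite powR_inv1 ?sqr_ge0//.
  by have [->|f0] := eqVneq (f x) 0; rewrite ?mul0r ?invr0//; field.
apply: measurable_funM => //.
exact: (measurableT_comp (@measurable_powR R (-1)) (measurable_funX 2 mf)).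
Qed.

Lemma measurable_deviance d (T : measurableType d) (R : realType)
    (a b c w u v : T -> R) :
  measurable_fun setT a -> measurable_fun setT b -> measurable_fun setT c ->
  measurable_fun setT w -> measurable_fun setT u -> measurable_fun setT v ->
  measurable_fun setT (fun t => deviance (a t) (b t) (c t) (w t) (u t) (v t)).
Proof.
move=> ma mb mc mw mu mv; rewrite /deviance.
have mln (f : T -> R) : measurable_fun setT f -> measurable_fun setT (fun t => ln (f t)).
  by move=> mf; exact: (measurableT_comp (@measurable_ln R) mf).
apply: measurable_funD; last by apply: measurable_funM => //; exact: measurable_funV.
apply: measurable_funD; last first.
  apply: measurable_funM; last exact: measurable_funV.
  apply: measurable_funD; last by apply: measurable_funM => //; exact: measurable_funX.
  apply: measurable_funB => //; apply: measurable_funM => //.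
  exact: measurable_funM.
by apply: measurable_funD; [apply: measurable_funD => //|]; exact: mln.
Qed.

Lemma measurable_structure_deviance d (T : measurableType d) (R : realType)
    (S : structure) (a b c : T -> R) (th : T -> R * (R * R)) :
  measurable_fun setT a -> measurable_fun setT b -> measurable_fun setT c ->
  measurable_fun setT th ->
  measurable_fun setT (fun t => structure_deviance S (a t) (b t) (c t) (th t)).
Proof.
move=> ma mb mc mth.
have m1 : measurable_fun setT (fun t => (th t).1) by exact: (measurableT_comp measurable_fst mth).
have m2 : measurable_fun setT (fun t => (th t).2) by exact: (measurableT_comp measurable_snd mth).
have m21 : measurable_fun setT (fun t => (th t).2.1) by exact: (measurableT_comp measurable_fst m2).
have m22 : measurable_fun setT (fun t => (th t).2.2) by exact: (measurableT_comp measurable_snd m2).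
by case: S => /=; exact: measurable_deviance.
Qed.

Lemma measurable_variance_space (R : realType) :
  measurable (variance_space : set (R * R)).
Proof.
rewrite (_ : variance_space = `]0, +oo[%classic `*` `]0, +oo[%classic).
  by apply: measurableX; exact: measurable_itv.
by apply/seteqP; split => -[u v] /=; rewrite !in_itv/= !andbT.
Qed.

Lemma measurable_param_space (R : realType) :
  measurable (param_space : set (R * (R * R))).
Proof.
rewrite (_ : param_space = setT `*` variance_space).
  by apply: measurableX => //; exact: measurable_variance_space.
by apply/seteqP; split => -[w [u v]] /=; [|case].
Qed.

Lemma ge0_integral_separable d1 d2 (T1 : measurableType d1) (T2 : measurableType d2)
    (R : realType) (m1 : {sigma_finite_measure set T1 -> \bar R})
    (m2 : {sigma_finite_measure set T2 -> \bar R}) (f : T1 -> R) (g : T2 -> R) :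
  measurable_fun setT f -> measurable_fun setT g ->
  (forall x, 0 <= f x) -> (forall y, 0 <= g y) ->
  (\int[(m1 \x m2)%E]_z (f z.1 * g z.2)%:E =
   \int[m1]_x (f x)%:E * \int[m2]_y (g y)%:E)%E.
Proof.
move=> mf mg f0 g0.
have mfe : measurable_fun setT (fun x => (f x)%:E) by apply/measurable_EFinP.
have mge : measurable_fun setT (fun x => (g x)%:E) by apply/measurable_EFinP.
rewrite fubini_tonelli1/=; last 2 first.
- apply/measurable_EFinP; apply: measurable_funM.
    exact: (measurableT_comp mf measurable_fst).
  exact: (measurableT_comp mg measurable_snd).
- by move=> z; rewrite lee_fin mulr_ge0.
rewrite -ge0_integralZr//=.
- apply: eq_integral => x _; rewrite /fubini_F/=.
  under eq_integral do rewrite EFinM.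
  by rewrite ge0_integralZl_EFin// => y _; rewrite lee_fin.
- by move=> x _; rewrite lee_fin.
- by apply: integral_ge0 => y _; rewrite lee_fin.
Qed.

Definition gauss_bump {R : realType} (lam m x : R) : R := expR (- (lam / 2) * (x - m) ^+ 2).

Lemma measurable_gauss_bump {R : realType} (lam m : R) : measurable_fun setT (gauss_bump lam m).
Proof.
apply: (measurableT_comp (@measurable_expR R)); apply: measurable_funM => //.
by apply: measurable_funX; exact: measurable_funB.
Qed.

Lemma integral_gauss_bump {R : realType} (lam m : R) : 0 < lam ->
  (\int[lebesgue_measure]_x (gauss_bump lam m x)%:E = (Num.sqrt (2 * pi / lam))%:E)%E.
Proof.
move=> lam0; pose s := Num.sqrt lam^-1.
have s0 : s != 0 by rewrite sqrtr_eq0 -ltNge invr_gt0.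
have s2 : s ^+ 2 = lam^-1 by rewrite sqr_sqrtr// invr_ge0 ltW.
have pE : Num.sqrt (2 * pi / lam) = (normal_peak s)^-1.
  rewrite /normal_peak invrK s2; congr Num.sqrt; rewrite -mulr_natl; ring.
have bE x : gauss_bump lam m x = Num.sqrt (2 * pi / lam) * normal_pdf m s x.
  rewrite normal_pdfE// pE mulKf ?gt_eqF ?normal_peak_gt0//.
  rewrite /gauss_bump /normal_fun s2; congr expR; rewrite -mulr_natl; field.
  by rewrite gt_eqF.
under eq_integral do rewrite bE EFinM.
rewrite ge0_integralZl_EFin//=.
- by rewrite integral_normal_pdf mule1.
- by move=> x _; rewrite lee_fin normal_pdf_ge0.
- by apply/measurable_EFinP; exact: measurable_normal_pdf.
Qed.

Lemma integral_gauss_bump3 {R : realType} (lam m0 m1 m2 : R) : 0 < lam ->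
  (\int[lebesgue3]_z (gauss_bump lam m0 z.1 * (gauss_bump lam m1 z.2.1 * gauss_bump lam m2 z.2.2))%:E
   = (Num.sqrt (2 * pi / lam) ^+ 3)%:E)%E.
Proof.
move=> lam0.
have b0 m x : 0 <= gauss_bump lam m x by exact: expR_ge0.
have mb := @measurable_gauss_bump R lam.
apply: etrans; first apply: (@ge0_integral_separable _ _ (measurableTypeR R)
  (measurableTypeR R * measurableTypeR R)%type R (@lebesgue_measure R) (@lebesgue2 R)
  (gauss_bump lam m0) (fun y => gauss_bump lam m1 y.1 * gauss_bump lam m2 y.2)) => //.
- exact: mb.
- apply: measurable_funM.
    exact: (measurableT_comp (mb m1) measurable_fst).
  exact: (measurableT_comp (mb m2) measurable_snd).
- by move=> y; rewrite mulr_ge0.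
rewrite integral_gauss_bump// (_ : Num.sqrt _ ^+ 3 = Num.sqrt (2 * pi / lam) *
  (Num.sqrt (2 * pi / lam) * Num.sqrt (2 * pi / lam))); last by ring.
rewrite EFinM; congr (_ * _)%E.
apply: etrans; first apply: (@ge0_integral_separable _ _ (measurableTypeR R)
  (measurableTypeR R) R (@lebesgue_measure R) (@lebesgue_measure R)
  (gauss_bump lam m1) (gauss_bump lam m2)) => //; [exact: mb|exact: mb|].
by rewrite !integral_gauss_bump// EFinM.
Qed.

(** * Upper bound on the evidence of the structures with an edge *)

Lemma fine_le_EFin {R : realType} (x : \bar R) (r : R) :
  (0 <= x)%E -> (x <= r%:E)%E -> fine x <= r.
Proof. by case: x => [x| |]//=; rewrite lee_fin. Qed.

Lemma fine_ge_EFin {R : realType} (x : \bar R) (r s : R) :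
  (x <= s%:E)%E -> (r%:E <= x)%E -> r <= fine x.
Proof. by case: x => [x| |]//=; rewrite lee_fin. Qed.

Lemma measurable_likelihood {R : realType} n (x : nat -> R * R) S :
  measurable_fun param_space (likelihood n x S).
Proof.
apply: (eq_measurable_fun (fun theta => expR (- (n%:R / 2) * structure_deviance S
    (mean_of sq1 n x) (mean_of sq2 n x) (mean_of cross n x) theta))).
  by move=> theta; rewrite inE => htheta; rewrite likelihoodE.
apply: measurable_funTS; apply: (measurableT_comp (@measurable_expR R)).
apply: measurable_funM => //.
exact: measurable_structure_deviance.
Qed.

(** A likelihood times a prior is integrated by a domination: a Gaussian times
    a bound on the prior where the likelihood concentrates, and a small
    multiple of the prior itself elsewhere. *)
Lemma Rintegral_concentrated {R : realType} (lik p : R * (R * R) -> R)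
    (A C k lam m0 m1 m2 : R) :
  0 < lam -> 0 <= A -> 0 <= C -> 0 <= k ->
  is_prob_density (@lebesgue3 R) param_space p ->
  measurable_fun param_space lik ->
  (forall theta, param_space theta -> 0 <= lik theta) ->
  (forall theta, param_space theta -> lik theta * p theta <=
    A * (C * (gauss_bump lam m0 theta.1 * (gauss_bump lam m1 theta.2.1 * gauss_bump lam m2 theta.2.2))
         + k * p theta)) ->
  \int[lebesgue3]_(theta in param_space) (lik theta * p theta) <=
    A * (C * Num.sqrt (2 * pi / lam) ^+ 3 + k).
Proof.
move=> lam0 A0 C0 k0 [mp p0 p1] mlik lik0 bnd.
have mD := measurable_param_space R.
pose G (z : R * (R * R)) := gauss_bump lam m0 z.1 * (gauss_bump lam m1 z.2.1 * gauss_bump lam m2 z.2.2).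
have G0 z : 0 <= G z by rewrite !mulr_ge0 ?expR_ge0.
have mG : measurable_fun setT G.
  have mb := @measurable_gauss_bump R lam.
  have m2' : measurable_fun setT (fun z : R * (R * R) => z.2) by exact: measurable_snd.
  apply: measurable_funM; first exact: (measurableT_comp (mb m0) measurable_fst).
  apply: measurable_funM.
    exact: (measurableT_comp (mb m1) (measurableT_comp measurable_fst m2')).
  exact: (measurableT_comp (mb m2) (measurableT_comp measurable_snd m2')).
have mGD : measurable_fun param_space G by exact: measurable_funTS.
rewrite /Rintegral; apply: fine_le_EFin.
  by apply: integral_ge0 => z Dz; rewrite lee_fin mulr_ge0 ?lik0 ?p0.
apply: (@le_trans _ _ (\int[lebesgue3]_(z in param_space)
    (A%:E * (C%:E * (G z)%:E + k%:E * (p z)%:E)))%E).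
  apply: ge0_le_integral => //.
  - by move=> z Dz; rewrite lee_fin mulr_ge0 ?lik0 ?p0.
  - by apply/measurable_EFinP; exact: measurable_funM.
  - by apply/measurable_EFinP; apply: measurable_funM => //;
      apply: measurable_funD; exact: measurable_funM.
have mGE : measurable_fun param_space (fun z => (G z)%:E) by apply/measurable_EFinP.
have mpE : measurable_fun param_space (fun z => (p z)%:E) by apply/measurable_EFinP.
have G0E z : param_space z -> (0 <= (G z)%:E)%E by rewrite lee_fin.
have p0E z : param_space z -> (0 <= (p z)%:E)%E by rewrite lee_fin; exact: p0.
rewrite ge0_integralZl_EFin//; last 2 first.
- by move=> z Dz; rewrite adde_ge0// mule_ge0// ?G0E ?p0E// lee_fin.
- by apply: emeasurable_funD; exact: emeasurable_funM.
rewrite ge0_integralD//; last 4 first.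
- by move=> z Dz; rewrite mule_ge0// ?G0E// lee_fin.
- exact: emeasurable_funM.
- by move=> z Dz; rewrite mule_ge0// ?p0E// lee_fin.
- exact: emeasurable_funM.
rewrite !ge0_integralZl_EFin// p1 mule1.
rewrite EFinM EFinD EFinM lee_wpmul2l ?lee_fin// leeD2r// lee_wpmul2l ?lee_fin//.
rewrite -(integral_gauss_bump3 _ m0 m1 m2)//.
apply: ge0_subset_integral => //.
- by apply/measurable_EFinP.
- by move=> z _; rewrite lee_fin; exact: G0.
Qed.

(** The form of the Laplace upper bound common to both edges: a lower bound on
    the deviance, quadratic in a box and constant outside, bounds the
    evidence. *)
Lemma evidence_le_of_gap {R : realType} (S : structure) (p : R * (R * R) -> R)
    (t1 t2 del C k D0 m0 m1 m2 : R) (n : nat) (x : nat -> R * R) :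
  is_prob_density (@lebesgue3 R) param_space p -> 0 <= C ->
  (forall w u v, 0 < u -> 0 < v -> box del t1 t2 w u v -> p (w, (u, v)) <= C) ->
  0 < k -> (0 < n)%N ->
  (forall w u v, 0 < u -> 0 < v ->
    D0 + k * (if box del t1 t2 w u v then
                (w - m0) ^+ 2 + (u - m1) ^+ 2 + (v - m2) ^+ 2 else 1) <=
    structure_deviance S (mean_of sq1 n x) (mean_of sq2 n x) (mean_of cross n x)
      (w, (u, v))) ->
  \int[lebesgue3]_(theta in param_space) (likelihood n x S theta * p theta) <=
  expR (- (n%:R / 2) * D0) *
    (C * Num.sqrt (2 * pi / (n%:R * k)) ^+ 3 + expR (- (n%:R * k / 2))).
Proof.
move=> hp C0 hC k0 n0 gap; have [mp p0 p1] := hp.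
have nR : 0 < n%:R :> R by rewrite ltr0n.
have nk0 : 0 < n%:R * k by rewrite mulr_gt0.
apply: (@Rintegral_concentrated _ _ _ _ _ _ _ m0 m1 m2) => //.
- exact: measurable_likelihood.
- by move=> theta Dth; rewrite likelihoodE// expR_ge0.
move=> [w [u v]] Dth; have [/= u0 v0] := Dth.
rewrite likelihoodE//=.
have := gap w u v u0 v0.
set dev := structure_deviance _ _ _ _ _; set q := _ + (v - m2) ^+ 2 => hdev.
have pz := p0 _ Dth.
pose B := gauss_bump (n%:R * k) m0 w * (gauss_bump (n%:R * k) m1 u * gauss_bump (n%:R * k) m2 v).
have n2 : 0 < n%:R / 2 :> R by rewrite divr_gt0.
case: ifPn hdev => [hbox|_] hdev.
- have e1 : expR (- (n%:R / 2) * dev) <= expR (- (n%:R / 2) * D0) * B.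
    rewrite /B /gauss_bump -!expRD ler_expR.
    apply: (@le_trans _ _ (- (n%:R / 2) * (D0 + k * q))).
      by rewrite !mulNr lerN2 ler_pM2l.
    by rewrite /q le_eqVlt; apply/orP; left; apply/eqP; ring.
  apply: (@le_trans _ _ (expR (- (n%:R / 2) * D0) * B * C)).
    by rewrite ler_pM ?expR_ge0// hC.
  by rewrite -mulrA ler_wpM2l ?expR_ge0// mulrC lerDl mulr_ge0// expR_ge0.
- have e1 : expR (- (n%:R / 2) * dev) <=
      expR (- (n%:R / 2) * D0) * expR (- (n%:R * k / 2)).
    rewrite -expRD ler_expR.
    apply: (@le_trans _ _ (- (n%:R / 2) * (D0 + k * 1))).
      by rewrite !mulNr lerN2 ler_pM2l.
    by rewrite le_eqVlt; apply/orP; left; apply/eqP; ring.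
  apply: (@le_trans _ _ (expR (- (n%:R / 2) * D0) * expR (- (n%:R * k / 2))
      * p (w, (u, v)))).
    by rewrite ler_wpM2r.
  by rewrite -mulrA ler_wpM2l ?expR_ge0// lerDr !mulr_ge0 ?expR_ge0.
Qed.

Lemma expRN_le {R : realType} (y : R) : 0 <= y -> y ^+ 2 * expR (- y) <= 4.
Proof.
move=> y0; rewrite expRN ler_pdivrMr ?expR_gt0//.
(* As [exp (y/2) >= 1 + y/2], its square is at least [y^2 / 4]. *)
have -> : expR y = expR (y / 2) ^+ 2 by rewrite -expRM_natl; congr expR; field.
have := @expR_ge1Dx R (y / 2); set z := expR _ => hz.
have : 0 < z by exact: expR_gt0.
nra.
Qed.

(** The Gaussian term is exactly of order [n^(-3/2)], one factor [n^(-1/2)]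
    for each of the three parameters, and the exponential tail is smaller. *)
Lemma laplace_rate {R : realType} (C k : R) (n : nat) : 0 <= C -> 0 < k -> (0 < n)%N ->
  Num.sqrt n%:R * n%:R *
    (C * Num.sqrt (2 * pi / (n%:R * k)) ^+ 3 + expR (- (n%:R * k / 2))) <=
  C * Num.sqrt (2 * pi / k) ^+ 3 + 16 / k ^+ 2.
Proof.
move=> C0 k0 n0.
have nR : 1 <= n%:R :> R by rewrite ler1n.
have nR0 : 0 < n%:R :> R by rewrite ltr0n.
set s := Num.sqrt n%:R.
have s2 : s ^+ 2 = n%:R by rewrite sqr_sqrtr.
have s0 : 0 < s by rewrite sqrtr_gt0.
have -> : Num.sqrt (2 * pi / (n%:R * k)) = Num.sqrt (2 * pi / k) / s.
  rewrite invfM mulrCA mulrC sqrtrM ?mulr_ge0 ?invr_ge0 ?pi_ge0 ?(ltW k0)//.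
  by rewrite sqrtrV// -/s mulrC.
rewrite mulrDr lerD//.
  rewrite le_eqVlt; apply/orP; left; apply/eqP.
  by rewrite -s2; field; rewrite gt_eqF.
have := @expRN_le R (n%:R * k / 2) (ltW (divr_gt0 (mulr_gt0 nR0 k0) (ltr0n _ 2))).
set e := expR _ => he.
have e0 : 0 < e by exact: expR_gt0.
have sn : s <= n%:R.
  have : 1 <= s by rewrite -sqrtr1 ler_sqrt.
  rewrite -s2; nra.
rewrite ler_pdivlMr ?exprn_gt0//.
apply: (@le_trans _ _ (n%:R * n%:R * e * k ^+ 2)).
  by rewrite !ler_wpM2r ?sqr_ge0 ?(ltW e0).
have -> : n%:R * n%:R * e * k ^+ 2 = 4 * ((n%:R * k / 2) ^+ 2 * e) by field.
lra.
Qed.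

Lemma deviance_sym {R : realType} (a b : R) : deviance a b 0 0 a b = deviance b a 0 0 b a.
Proof. by rewrite /deviance; ring. Qed.

(** The evidence of independence is of order [1/n]; the further factor
    [n^(-1/2)] is what an edge loses. The constant [A] depends on [K], which
    bounds [n c^2]. *)
Lemma edge_evidence_le {R : realType} (S : structure) (p : R * (R * R) -> R)
    (t1 t2 del C K : R) :
  S <> S3 -> 0 < t1 -> 0 < t2 -> 0 < del -> del <= t1 / 2 -> del <= t2 / 2 ->
  is_prob_density (@lebesgue3 R) param_space p -> 0 <= C ->
  (forall w u v, 0 < u -> 0 < v -> box del t1 t2 w u v -> p (w, (u, v)) <= C) ->
  exists2 eta, 0 < eta & exists2 A, 0 <= A & forall n x, (0 < n)%N ->
    let a := mean_of sq1 n x in let b := mean_of sq2 n x in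
    let c := mean_of cross n x in
    `|a - t1| <= del / 4 -> `|b - t2| <= del / 4 -> c ^+ 2 <= eta ->
    n%:R * c ^+ 2 <= K ->
    Num.sqrt n%:R * n%:R *
      \int[lebesgue3]_(theta in param_space) (likelihood n x S theta * p theta) <=
    expR (- (n%:R / 2) * deviance a b 0 0 a b) * A.
Proof.
move=> hS t10 t20 d0 dt1 dt2 hp C0 hC.
suff [eta eta0 [k k0 H]] : exists2 eta, 0 < eta & exists2 k, 0 < k &
    forall n x, (0 < n)%N ->
    let a := mean_of sq1 n x in let b := mean_of sq2 n x in
    let c := mean_of cross n x in
    `|a - t1| <= del / 4 -> `|b - t2| <= del / 4 -> c ^+ 2 <= eta ->
    exists m0 m1 m2, forall w u v, 0 < u -> 0 < v ->
    deviance a b 0 0 a b - 4 / (t1 * t2) * c ^+ 2 +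
      k * (if box del t1 t2 w u v then
                (w - m0) ^+ 2 + (u - m1) ^+ 2 + (v - m2) ^+ 2 else 1) <=
    structure_deviance S a b c (w, (u, v)).
  exists eta => //.
  exists (expR (2 / (t1 * t2) * K) * (C * Num.sqrt (2 * pi / k) ^+ 3 + 16 / k ^+ 2)).
    apply: mulr_ge0; first exact: expR_ge0.
    by rewrite addr_ge0 ?mulr_ge0 ?invr_ge0 ?sqr_ge0 ?exprn_ge0.
  move=> n x n0 a b c ha hb hc hK.
  have [m0 [m1 [m2 gap]]] := H n x n0 ha hb hc.
  have := evidence_le_of_gap _ _ _ _ _ _ _ _ _ _ _ _ _ hp C0 hC k0 n0 gap.
  set I := Rintegral _ _ _ => hI.
  have sn : 0 <= Num.sqrt n%:R * n%:R :> R by rewrite mulr_ge0.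
  apply: (le_trans (ler_wpM2l sn hI)).
  have hE : expR (- (n%:R / 2) * (deviance a b 0 0 a b - 4 / (t1 * t2) * c ^+ 2)) <=
      expR (- (n%:R / 2) * deviance a b 0 0 a b) * expR (2 / (t1 * t2) * K).
    rewrite -expRD ler_expR mulrBr lerD2l.
    have -> : - (- (n%:R / 2) * (4 / (t1 * t2) * c ^+ 2)) =
      2 / (t1 * t2) * (n%:R * c ^+ 2) by field; rewrite !gt_eqF.
    by rewrite ler_wpM2l// divr_ge0// mulr_ge0// ltW.
  rewrite mulrCA [leRHS]mulrA; apply: ler_pM; [exact: expR_ge0| |exact: hE|exact: laplace_rate].
  rewrite mulr_ge0// addr_ge0 ?expR_ge0// mulr_ge0// exprn_ge0//.
have [eta1 eta10 small1] := small_cross _ _ t10 d0 dt1.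
have [eta2 eta20 small2] := small_cross _ _ t20 d0 dt2.
case: S hS => // _.
- have [k k0 gap] := deviance_gap _ _ _ t10 t20 d0 dt1 dt2.
  exists eta2 => //; exists k => // n x n0 a b c ha hb hc.
  have [c1 c2] := small2 _ _ hb hc.
  exists (c / b), (a - c ^+ 2 / b), b => w u v u0 v0.
  exact: gap.
- have [k k0 gap] := deviance_gap _ _ _ t20 t10 d0 dt2 dt1.
  exists eta1 => //; exists k => // n x n0 a b c ha hb hc.
  have [c1 c2] := small1 _ _ ha hc.
  exists (c / a), a, (b - c ^+ 2 / a) => w u v u0 v0.
  have := gap b a c w v u v0 u0 hb ha c1 c2.
  rewrite (deviance_sym b a) (mulrC t2) /box (andbC (`|v - t2| < del)).
  by rewrite (addrAC _ ((v - _) ^+ 2)).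
Qed.

(** * Lower bound on the evidence of the independence structure *)

Lemma deviance_independence {R : realType} (a b u v : R) :
  0 < a -> 0 < b -> 0 < u -> 0 < v ->
  deviance a b 0 0 u v = deviance a b 0 0 a b + (excess u a + excess v b).
Proof.
move=> a0 b0 u0 v0; rewrite (deviance_split a b 0 0)//.
by rewrite expr0n/= !mul0r !subr0 subrr expr0n/= mulr0 !mul0r !addr0.
Qed.

Lemma lebesgue2_square {R : realType} (a b h : R) : 0 < h ->
  lebesgue2 (`[a, a + h]%classic `*` `[b, b + h]%classic) = (h ^+ 2)%:E.
Proof.
move=> h0.
have len c : @lebesgue_measure R `[c, c + h]%classic = h%:E.
  by rewrite lebesgue_measure_itv/= lte_fin ltrDl h0 -EFinB addrAC subrr add0r.
apply: etrans; first apply: (product_measure1E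
  (@lebesgue_measure R) (@lebesgue_measure R)); [exact: measurable_itv..|].
exact: (f_equal2 mule (len a) (len b)).
Qed.

(** On the square of side [n^(-1/2)] with corner at the maximum likelihood
    estimator, [excess_le] bounds [n] times the excess deviance, so that the
    likelihood is there at least a fixed fraction of its maximum. *)
Lemma independence_evidence_ge {R : realType} (p : R * R -> R) (t1 t2 del g : R) :
  0 < t1 -> 0 < t2 -> 0 < del -> del <= t1 / 2 -> del <= t2 / 2 ->
  is_prob_density (@lebesgue2 R) variance_space p -> 0 < g ->
  (forall u v, `|u - t1| < del -> `|v - t2| < del -> g <= p (u, v)) ->
  exists2 B, 0 < B & forall n x, (0 < n)%N ->
    let a := mean_of sq1 n x in let b := mean_of sq2 n x in
    `|a - t1| <= del / 4 -> `|b - t2| <= del / 4 -> (Num.sqrt n%:R)^-1 <= del / 2 ->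
    expR (- (n%:R / 2) * deviance a b 0 0 a b) * B <=
    n%:R * \int[lebesgue2]_(t in variance_space) (likelihood n x S3 (0, t) * p t).
Proof.
move=> t10 t20 d0 dt1 dt2 [mp p0 p1] g0 hg.
exists (expR (- (2 / t1 ^+ 2 + 2 / t2 ^+ 2)) * g).
  by rewrite mulr_gt0// expR_gt0.
move=> n x n0 a b ha hb.
set c := mean_of cross n x.
have nR : 0 < n%:R :> R by rewrite ltr0n.
set h := _^-1 => hn.
have h0 : 0 < h by rewrite invr_gt0 sqrtr_gt0.
have h2 : h ^+ 2 = n%:R^-1 by rewrite exprVn sqr_sqrtr// ltW.
have /andP[a1 a2] : - (del / 4) <= a - t1 <= del / 4 by rewrite -ler_norml.
have /andP[b1 b2] : - (del / 4) <= b - t2 <= del / 4 by rewrite -ler_norml.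
have a0 : 0 < a by lra.
have b0 : 0 < b by lra.
have at1 : t1 / 2 <= a by lra.
have bt2 : t2 / 2 <= b by lra.
set D0 := deviance a b 0 0 a b.
pose l (t : R * R) := likelihood n x S3 (0, t).
have lE t : variance_space t -> l t =
    expR (- (n%:R / 2) * (D0 + (excess t.1 a + excess t.2 b))).
  case: t => u v [/= u0 v0].
  rewrite /l likelihoodE//= -/a -/b -/c /D0 -deviance_independence//.
  by congr (expR (_ * _)); rewrite /deviance; ring.
clearbody D0.
have mD := measurable_variance_space R.
have ml : measurable_fun variance_space l.
  have -> : l = (likelihood n x S3) \o (pair 0) by [].
  apply: (measurable_comp (measurable_param_space R)).
  - by move=> _ [t ht <-].
  - exact: measurable_likelihood.
  - by apply: measurable_funTS; exact: pair1_measurable.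
have l0 t : variance_space t -> 0 <= l t by move=> /lE ->; exact: expR_ge0.
have mlp : measurable_fun variance_space (fun t => (l t * p t)%:E).
  by apply/measurable_EFinP; exact: measurable_funM.
have lp0 t : variance_space t -> (0 <= (l t * p t)%:E)%E.
  by move=> Dt; rewrite lee_fin mulr_ge0 ?l0 ?p0.
have fin : (\int[lebesgue2]_(t in variance_space) (l t * p t)%:E <=
    (expR (- (n%:R / 2) * D0))%:E)%E.
  rewrite -[leRHS]mule1 -p1 -ge0_integralZl_EFin//; last by apply/measurable_EFinP.
  apply: ge0_le_integral => //.
  - by apply: measurable_funeM; apply/measurable_EFinP.
  - move=> t Dt; rewrite -EFinM lee_fin ler_wpM2r ?p0// lE// ler_expR.
    rewrite !mulNr lerN2 ler_pM2l ?divr_gt0// lerDl addr_ge0//; apply: excess_ge0 => //; by case: Dt.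
rewrite -ler_pdivrMl//; apply: (fine_ge_EFin _ _ _ fin).
(* The square lies inside the region where the prior is at least [g], and its
   area is [1/n]. *)
pose Q := `[a, a + h]%classic `*` `[b, b + h]%classic.
have mQ : measurable (Q : set (R * R)) by apply: measurableX; exact: measurable_itv.
have Qsub : Q `<=` variance_space.
  by move=> [u v] []/=; rewrite !in_itv/= => /andP[? _] /andP[? _]; split => /=; lra.
apply: (@le_trans _ _ (\int[lebesgue2]_(t in Q) (l t * p t)%:E)%E); last first.
  exact: ge0_subset_integral.
set low := expR (- (n%:R / 2) * D0) * (expR (- (2 / t1 ^+ 2 + 2 / t2 ^+ 2)) * g).
have low0 : 0 <= low by rewrite !mulr_ge0 ?expR_ge0// ltW.
have -> : (n%:R^-1 * low)%:E = (\int[lebesgue2]_(t in Q) (cst low%:E t))%E.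
  rewrite integral_cst//; apply/esym.
  apply: (etrans (congr1 (mule low%:E) (lebesgue2_square a b _ h0))).
  by rewrite h2 -EFinM mulrC.
apply: ge0_le_integral => //.
- exact: measurable_funS mlp.
move=> [u v] Quv; have Duv := Qsub _ Quv.
rewrite lee_fin lE//=.
move: Quv => []/=; rewrite !in_itv/= => /andP[u1 u2] /andP[v1 v2].
have u0 : 0 < u by lra.
have v0 : 0 < v by lra.
have ex z m t : 0 < t -> t / 2 <= m -> m <= z -> z <= m + h ->
    n%:R / 2 * excess z m <= 2 / t ^+ 2.
  move=> t0 tm mz zm; have m0 : 0 < m by lra.
  have z0 : 0 < z by lra.
  apply: (@le_trans _ _ (n%:R / 2 * (h ^+ 2 / (t / 2 * (t / 2))))).
    rewrite ler_pM2l ?divr_gt0//; apply: (le_trans (excess_le _ _ z0 m0)).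
    apply: ler_pM; rewrite ?sqr_ge0 ?invr_ge0 ?mulr_ge0 ?(ltW z0) ?(ltW m0)//.
      by rewrite ler_sqr ?nnegrE; lra.
    by rewrite lef_pV2 ?posrE ?mulr_gt0// ?divr_gt0// ler_pM ?divr_ge0 ?(ltW t0)//; lra.
  by rewrite h2 le_eqVlt; apply/orP; left; apply/eqP; field; rewrite !gt_eqF.
rewrite /low mulrA -expRD; apply: ler_pM; rewrite ?expR_ge0 ?(ltW g0)//.
  rewrite ler_expR mulrDr lerD2l mulNr lerN2 mulrDr.
  by apply: lerD; exact: ex.
by apply: hg; rewrite ltr_norml; apply/andP; split; lra.
Qed.

(** * The posterior on the event where the statistics are typical *)

Lemma locally_close {R : realType} (V : normedModType R) (f : V -> R) (x0 : V) (e : R) :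
  differentiable f x0 -> 0 < e ->
  exists2 del : R, 0 < del & forall x, ball x0 del x -> `|f x - f x0| < e.
Proof.
move=> /differentiable_continuous /cvgrPdist_lt fc e0.
have := fc _ e0; move=> /nbhs_ballP[del /= d0 H]; exists del => // x /H /=.
by rewrite distrC.
Qed.

Lemma near_inv_sqrt {R : realType} (e : R) : 0 < e ->
  \forall n \near \oo, (Num.sqrt n%:R)^-1 <= e.
Proof.
move=> e0; near=> n.
have n0 : (0 < n)%N by near: n; exists 1%N.
have nR : 0 < n%:R :> R by rewrite ltr0n.
have s0 : 0 < Num.sqrt n%:R :> R by rewrite sqrtr_gt0.
have : (e ^- 2) <= n%:R by near: n; exact: nbhs_infty_ger.
rewrite -{1}[n%:R](sqr_sqrtr (ltW nR)) => h.
rewrite -[e]invrK lef_pV2 ?posrE ?invr_gt0//.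
rewrite -ler_sqr ?nnegrE ?invr_ge0 ?(ltW e0) ?(ltW s0)//.
by rewrite exprVn.
Unshelve. all: by end_near. Qed.

Lemma near_div_le {R : realType} (V e : R) : 0 < e ->
  \forall n \near \oo, V / n%:R <= e.
Proof.
move=> e0; near=> n.
have n0 : (0 < n)%N by near: n; exists 1%N.
rewrite ler_pdivrMr ?ltr0n// mulrC -ler_pdivrMr//.
by near: n; exact: nbhs_infty_ger.
Unshelve. all: by end_near. Qed.

Lemma ratio_bound {R : realType} (s n L A1 A2 B E1 E2 E3 : R) :
  0 <= s -> 0 < n -> 0 < L -> 0 < B -> 0 <= E1 -> 0 <= E2 ->
  s * n * E1 <= L * A1 -> s * n * E2 <= L * A2 -> L * B <= n * E3 ->
  `|s * (1 - E3 / (E1 + (E2 + E3)))| <= (A1 + A2) / B.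
Proof.
move=> s0 n0 L0 B0 E10 E20 h1 h2 h3.
have LB : 0 < L * B by exact: mulr_gt0.
have nE3 : 0 < n * E3 by lra.
have E30 : 0 < E3 by rewrite -(pmulr_rgt0 _ n0).
have -> : s * (1 - E3 / (E1 + (E2 + E3))) = s * (E1 + E2) / (E1 + (E2 + E3)).
  by field; apply/lt0r_neq0; lra.
have num0 : 0 <= s * (E1 + E2) by rewrite mulr_ge0// addr_ge0.
rewrite ger0_norm; last by rewrite divr_ge0//; lra.
apply: (@le_trans _ _ (s * (E1 + E2) / E3)).
  by rewrite ler_wpM2l// lef_pV2 ?posrE; lra.
have -> : s * (E1 + E2) / E3 = (s * n * E1 + s * n * E2) / (n * E3).
  by field; rewrite !gt_eqF.
have -> : (A1 + A2) / B = (L * A1 + L * A2) / (L * B) by field; rewrite !gt_eqF.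
apply: ler_pM; [|by rewrite invr_ge0 ltW|exact: lerD|by rewrite lef_pV2 ?posrE].
by rewrite -mulrDr mulrAC mulr_ge0// ltW.
Qed.

(** The deterministic core: on every sample whose statistics are typical, the
    weight of the two edge structures is of order [n^(-1/2)]. *)
Lemma posterior_bound {R : realType} (t1 t2 : R)
    (pi1 pi2 : R * (R * R) -> R) (pi3 : R * R -> R) :
  0 < t1 -> 0 < t2 ->
  is_prob_density (@lebesgue3 R) param_space pi1 ->
  is_prob_density (@lebesgue3 R) param_space pi2 ->
  is_prob_density (@lebesgue2 R) variance_space pi3 ->
  differentiable pi1 (0, (t1, t2)) -> differentiable pi2 (0, (t1, t2)) ->
  differentiable pi3 (t1, t2) -> 0 < pi3 (t1, t2) ->
  exists2 eta, 0 < eta & forall K, 0 <= K -> exists M : R, \forall n \near \oo,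
    forall x : nat -> R * R,
      `|mean_of sq1 n x - t1| <= eta -> `|mean_of sq2 n x - t2| <= eta ->
      n%:R * mean_of cross n x ^+ 2 <= K ->
      `|Num.sqrt n%:R * (1 - posterior pi1 pi2 pi3 n x S3)| <= M.
Proof.
move=> t10 t20 h1 h2 h3 d1 d2 d3 p3.
have [del1 del10 near1] := locally_close _ _ _ _ d1 (@ltr01 R).
have [del2 del20 near2] := locally_close _ _ _ _ d2 (@ltr01 R).
have [del3 del30 near3] := locally_close _ _ _ _ d3 (divr_gt0 p3 (ltr0n R 2)).
(* A single box on which the three priors are controlled and which stays away
   from zero variances. *)
pose del := Num.min (Num.min del1 (Num.min del2 del3)) (Num.min (t1 / 2) (t2 / 2)).
have [dd1 dd2 dd3] : [/\ del <= del1, del <= del2 & del <= del3].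
  by rewrite /del !ge_min !lexx !orbT.
have [dt1 dt2] : del <= t1 / 2 /\ del <= t2 / 2 by rewrite /del !ge_min !lexx !orbT.
have d0 : 0 < del by rewrite /del !lt_min del10 del20 del30 !divr_gt0.
clearbody del.
pose C1 := `|pi1 (0, (t1, t2))| + 1; pose C2 := `|pi2 (0, (t1, t2))| + 1.
have C10 : 0 <= C1 by rewrite addr_ge0.
have C20 : 0 <= C2 by rewrite addr_ge0.
have hC1 w u v : 0 < u -> 0 < v -> box del t1 t2 w u v -> pi1 (w, (u, v)) <= C1.
  move=> _ _ /and3P[hw hu hv].
  have /near1 : ball (0 : R, (t1, t2)) del1 (w, (u, v)).
    by split; [|split]; rewrite -ball_normE/= ?sub0r ?normrN 1?distrC;
      [move: hw|move: hu|move: hv] => /lt_le_trans; apply.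
  rewrite ltr_norml /C1 => /andP[_ ?]; have := ler_norm (pi1 (0, (t1, t2))); lra.
have hC2 w u v : 0 < u -> 0 < v -> box del t1 t2 w u v -> pi2 (w, (u, v)) <= C2.
  move=> _ _ /and3P[hw hu hv].
  have /near2 : ball (0 : R, (t1, t2)) del2 (w, (u, v)).
    by split; [|split]; rewrite -ball_normE/= ?sub0r ?normrN 1?distrC;
      [move: hw|move: hu|move: hv] => /lt_le_trans; apply.
  rewrite ltr_norml /C2 => /andP[_ ?]; have := ler_norm (pi2 (0, (t1, t2))); lra.
have hg u v : `|u - t1| < del -> `|v - t2| < del -> pi3 (t1, t2) / 2 <= pi3 (u, v).
  move=> hu hv.
  have /near3 : ball (t1, t2) del3 (u, v).
    by split; rewrite -ball_normE/= distrC; [move: hu|move: hv] => /lt_le_trans; apply.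
  rewrite ltr_norml => /andP[? _]; lra.
have [B B0 lowB] := independence_evidence_ge _ _ _ _ _ t10 t20 d0 dt1 dt2 h3
  (divr_gt0 p3 (ltr0n R 2)) hg.
exists (del / 4); first by rewrite divr_gt0.
move=> K K0.
have S13 : S1 <> S3 by []. have S23 : S2 <> S3 by [].
have [eta1 e10 [A1 A10 up1]] := edge_evidence_le _ _ _ _ _ _ K S13 t10 t20 d0 dt1 dt2 h1 C10 hC1.
have [eta2 e20 [A2 A20 up2]] := edge_evidence_le _ _ _ _ _ _ K S23 t10 t20 d0 dt1 dt2 h2 C20 hC2.
exists ((A1 + A2) / B); near=> n => x ha hb hc.
have n0 : (0 < n)%N by near: n; exists 1%N.
have nR : 0 < n%:R :> R by rewrite ltr0n.
have c2K : mean_of cross n x ^+ 2 <= K / n%:R by rewrite ler_pdivlMr// mulrC.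
have KN eta : 0 < eta -> K / eta <= n%:R -> mean_of cross n x ^+ 2 <= eta.
  by move=> eta0 Ke; apply: (le_trans c2K); rewrite ler_pdivrMr// mulrC -ler_pdivrMr.
have c1 : mean_of cross n x ^+ 2 <= eta1.
  by apply: KN => //; near: n; exact: nbhs_infty_ger.
have c2 : mean_of cross n x ^+ 2 <= eta2.
  by apply: KN => //; near: n; exact: nbhs_infty_ger.
have hn : (Num.sqrt n%:R)^-1 <= del / 2.
  by near: n; apply: near_inv_sqrt; rewrite divr_gt0.
have := lowB n x n0 ha hb hn.
have := up1 n x n0 ha hb c1 hc; have := up2 n x n0 ha hb c2 hc.
rewrite /posterior !big_cons big_nil addr0 /evidence.
set L := expR _; set E1 := Rintegral _ _ _; set E2 := Rintegral _ _ _.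
set E3 := Rintegral _ _ _ => u2 u1 u3.
apply: (@ratio_bound _ _ n%:R L) => //; first exact: expR_gt0.
- apply: Rintegral_ge0 => th Dth; rewrite likelihoodE// mulr_ge0 ?expR_ge0//.
  by case: h1 => _ h _; exact: h.
- apply: Rintegral_ge0 => th Dth; rewrite likelihoodE// mulr_ge0 ?expR_ge0//.
  by case: h2 => _ h _; exact: h.
Unshelve. all: by end_near. Qed.

(** * Moments of the centered normal law *)

(** The Radon-Nikodym derivative agrees almost everywhere with any density. *)
Lemma ge0_integral_density d (T : measurableType d) (R : realType)
    (mu : {sigma_finite_measure set T -> \bar R}) (nu : {finite_measure set T -> \bar R})
    (p : T -> R) (f : T -> R) :
  measurable_fun setT p -> (forall x, 0 <= p x) ->
  (forall A, measurable A -> nu A = (\int[mu]_(x in A) (p x)%:E)%E) ->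
  measurable_fun setT f -> (forall x, 0 <= f x) ->
  (\int[nu]_x (f x)%:E = \int[mu]_x (f x * p x)%:E)%E.
Proof.
move=> mp p0 nuE mf f0.
have dom : nu `<< mu.
  apply/null_content_dominatesP => A mA muA; rewrite nuE//.
  by apply: null_set_integral => //; apply/measurable_EFinP; exact: measurable_funTS.
have mfE : measurable_fun setT (fun x => (f x)%:E) by apply/measurable_EFinP.
have mpE : measurable_fun setT (fun x => (p x)%:E) by apply/measurable_EFinP.
rewrite -(Radon_Nikodym_SigmaFinite.change_of_variables dom)//.
apply: ae_eq_integral => //.
- apply: emeasurable_funM => //.
  exact: measurable_int (Radon_Nikodym_SigmaFinite.f_integrable dom).
- by apply/measurable_EFinP; exact: measurable_funM.
have : ae_eq mu setT (Radon_Nikodym_SigmaFinite.f nu mu) (fun x => (p x)%:E).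
  apply: integral_ae_eq => //; first exact: Radon_Nikodym_SigmaFinite.f_integrable.
  by move=> E _ mE; rewrite -nuE// -(Radon_Nikodym_SigmaFinite.f_integral dom).
by apply: filterS => x /= h _; rewrite h// EFinM.
Qed.

Lemma ge0_integral_normal_prob {R : realType} (s : R) (f : R -> R) :
  measurable_fun setT f -> (forall x, 0 <= f x) ->
  (\int[normal_prob 0%R s]_x (f x)%:E =
   \int[lebesgue_measure]_x (f x * normal_pdf 0 s x)%:E)%E.
Proof.
move=> mf f0; apply: ge0_integral_density => //.
- exact: measurable_normal_pdf.
- exact: normal_pdf_ge0.
Qed.

(** The exponential [exp (- x^2 / (2 s^2))] is a square, and one of its
    factors absorbs [x^4]. *)
Lemma integrable_normal_pow4 {R : realType} (s : R) : s != 0 ->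
  (normal_prob 0%R s).-integrable setT (fun x : measurableTypeR R => (x ^+ 4)%:E).
Proof.
move=> s0.
have s20 : 0 < s ^+ 2 by rewrite exprn_even_gt0.
have m4 : measurable_fun setT (fun x : measurableTypeR R => x ^+ 4).
  exact: measurable_funX.
have p40 (x : R) : 0 <= x ^+ 4 by rewrite exprn_even_ge0.
apply/integrableP; split; first by apply/measurable_EFinP.
under eq_integral do rewrite /= ger0_norm//.
rewrite ge0_integral_normal_prob//.
pose c := 64 * s ^+ 4 * normal_peak s.
have s40 : 0 <= s ^+ 4 by rewrite exprn_even_ge0.
have lam0 : 0 < (2 * s ^+ 2)^-1 by rewrite invr_gt0 mulr_gt0.
apply: (@le_lt_trans _ _
    (\int[lebesgue_measure]_x (c%:E * (gauss_bump (2 * s ^+ 2)^-1 0 x)%:E))%E).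
  apply: ge0_le_integral => //=.
  - by move=> x _; rewrite lee_fin mulr_ge0 ?normal_pdf_ge0.
  - apply/measurable_EFinP; apply: measurable_funM => //.
    exact: measurable_normal_pdf.
  - by apply: measurable_funeM; apply/measurable_EFinP; exact: measurable_gauss_bump.
  - move=> x _; rewrite -EFinM lee_fin normal_pdfE// /normal_fun /gauss_bump subr0.
    (* In terms of [y] the density is [normal_peak s * exp (- 2 y)], and [y^2
       * exp (- y) <= 4]. *)
    pose y := x ^+ 2 / (4 * s ^+ 2).
    have y0 : 0 <= y by rewrite divr_ge0 ?sqr_ge0// mulr_ge0// ltW.
    have -> : x ^+ 4 = 16 * s ^+ 4 * y ^+ 2 by rewrite /y; field.
    have -> : - x ^+ 2 / (s ^+ 2 *+ 2) = - y + - y.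
      by rewrite /y -mulr_natl; field.
    have -> : - ((2 * s ^+ 2)^-1 / 2) * x ^+ 2 = - y by rewrite /y; field.
    rewrite expRD /c.
    have := expRN_le _ y0; have := expR_ge0 (- y); set e := expR _ => e0 he.
    have -> : 16 * s ^+ 4 * y ^+ 2 * (normal_peak s * (e * e)) =
      16 * s ^+ 4 * normal_peak s * e * (y ^+ 2 * e) by ring.
    have -> : 64 * s ^+ 4 * normal_peak s * e =
      16 * s ^+ 4 * normal_peak s * e * 4 by ring.
    apply: ler_wpM2l => //; apply: mulr_ge0 => //.
    by apply: mulr_ge0; [exact: mulr_ge0|exact: normal_peak_ge0].
rewrite ge0_integralZl_EFin//=.
- by rewrite integral_gauss_bump// -EFinM ltry.
- by move=> x _; rewrite lee_fin expR_ge0.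
- by apply/measurable_EFinP; exact: measurable_gauss_bump.
- by apply: mulr_ge0; [exact: mulr_ge0|exact: normal_peak_ge0].
Qed.

Lemma integrable_le_pow4 {R : realType} (s c : R) (f : R -> R) : s != 0 ->
  measurable_fun setT f -> (forall x, `|f x| <= c * (1 + x ^+ 4)) ->
  (normal_prob 0%R s).-integrable setT (fun x : measurableTypeR R => (f x)%:E).
Proof.
move=> s0 mf hf.
apply: (@le_integrable _ _ _ _ _ measurableT _
  (fun x : measurableTypeR R => (c%:E * ((cst 1 x)%:E + (x ^+ 4)%:E))%E)).
- by apply/measurable_EFinP.
- move=> x _; rewrite -EFinD -EFinM !abse_EFin lee_fin (le_trans (hf x))//.
  exact: ler_norm.
- apply: integrableZl => //; apply: integrableD => //; last exact: integrable_normal_pow4.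
  apply/integrableP; split; first by apply/measurable_EFinP.
  under eq_integral do rewrite /= normr1.
  rewrite integral_cst// mul1e.
  by apply: (le_lt_trans (probability_le1 _ _)) => //; rewrite ltry.
Qed.

(** The integrand is the likelihood ratio of the normal law [(m, u)] to the
    normal law [(0, t)]. *)
Lemma integral_normal_likelihood_ratio {R : realType} (t m u : R) : 0 < t -> 0 < u ->
  (\int[normal_prob 0%R (Num.sqrt t)]_x
    (expR (1 / 2 * (ln t - ln u + x ^+ 2 / t - (x - m) ^+ 2 / u)))%:E = 1)%E.
Proof.
move=> t0 u0; rewrite ge0_integral_normal_prob//; last first.
  apply: (measurableT_comp (@measurable_expR R)); apply: measurable_funM => //.
  apply: measurable_funB; first apply: measurable_funD => //.
    by apply: measurable_funM => //; exact: measurable_funX.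
  apply: measurable_funM => //; apply: measurable_funX; exact: measurable_funB.
rewrite -(integral_normal_pdf m (Num.sqrt u)).
apply: eq_integral => x _; congr EFin.
by rewrite !normal_pdf_sqrtE// -expRD; congr expR; rewrite subr0; field; rewrite !gt_eqF.
Qed.

(** Since [exp y >= 1 + y], the integral of the log-likelihood ratio of the
    normal law [(m, u)] to the law [(0, t)] is at most zero. It is an affine
    function of the two moments; taking [u = t] and [m] the mean forces the
    mean to vanish, and taking [m = 0] and [u] halfway between [t] and the
    second moment forces the latter to be [t]. *)
Lemma normal_moments {R : realType} (t : R) : 0 < t ->
  let nu := normal_prob 0%R (Num.sqrt t) in
  \int[nu]_x x = 0 /\ \int[nu]_x (x ^+ 2) = t.
Proof.
move=> t0 nu.
have s0 : Num.sqrt t != 0 by rewrite sqrtr_eq0 -ltNge.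
have mid : measurable_fun setT (fun x : measurableTypeR R => x) by exact: measurable_id.
have msq : measurable_fun setT (fun x : measurableTypeR R => x ^+ 2).
  exact: measurable_funX.
have iid : nu.-integrable setT (fun x : measurableTypeR R => x%:E).
  apply: (@integrable_le_pow4 _ _ 1) => // x.
  rewrite mul1r ler_norml; apply/andP; split.
    have := sqr_ge0 (x ^+ 2 - 1); have := sqr_ge0 (x + 1); nra.
  have := sqr_ge0 (x ^+ 2 - 1); have := sqr_ge0 (x - 1); nra.
have isq : nu.-integrable setT (fun x : measurableTypeR R => (x ^+ 2)%:E).
  apply: (@integrable_le_pow4 _ _ 1) => // x.
  rewrite mul1r ger0_norm ?sqr_ge0//.
  have := sqr_ge0 (x ^+ 2 - 1); nra.
have icst (c : R) : nu.-integrable setT (fun x : measurableTypeR R => c%:E).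
  apply: (@integrable_le_pow4 _ _ `|c|) => // x.
  by rewrite ler_peMr// lerDl exprn_even_ge0.
set M1 := Rintegral _ _ _; set M2 := Rintegral _ _ _.
have gibbs m u : 0 < u ->
    1 + 1 / 2 * (ln t - ln u - m ^+ 2 / u) + m / u * M1 + 1 / 2 * (1 / t - 1 / u) * M2 <= 1.
  move=> u0.
  set al := 1 + _; set be := m / u; set ga := 1 / 2 * (_ - _).
  pose Q (x : R) := 1 / 2 * (ln t - ln u + x ^+ 2 / t - (x - m) ^+ 2 / u).
  have int1 : nu.-integrable setT (fun x : measurableTypeR R => (be * x)%:E).
    by under [X in integrable _ _ X]eq_fun do rewrite EFinM; exact: integrableZl.
  have int2 : nu.-integrable setT (fun x : measurableTypeR R => (ga * x ^+ 2)%:E).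
    by under [X in integrable _ _ X]eq_fun do rewrite EFinM; exact: integrableZl.
  have int3 : nu.-integrable setT (fun x : measurableTypeR R => (al + be * x)%:E).
    by under [X in integrable _ _ X]eq_fun do rewrite EFinD; exact: integrableD.
  have int4 : nu.-integrable setT
      (fun x : measurableTypeR R => (al + be * x + ga * x ^+ 2)%:E).
    by under [X in integrable _ _ X]eq_fun do rewrite EFinD; exact: integrableD.
  have mQ : measurable_fun setT (fun x : measurableTypeR R => expR (Q x)).
    apply: (measurableT_comp (@measurable_expR R)); apply: measurable_funM => //.
    apply: measurable_funB; first apply: measurable_funD => //.
      by apply: measurable_funM.
    apply: measurable_funM => //; apply: measurable_funX; exact: measurable_funB.
  have E1 := integral_normal_likelihood_ratio t m u t0 u0.
  have intQ : nu.-integrable setT (fun x : measurableTypeR R => (expR (Q x))%:E).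
    apply/integrableP; split; first by apply/measurable_EFinP.
    under eq_integral do rewrite /= ger0_norm ?expR_ge0//.
    by rewrite E1 ltry.
  have IQ : \int[nu]_x expR (Q x) = 1 by rewrite /Rintegral E1.
  have -> : al + be * M1 + ga * M2 = \int[nu]_x (al + be * x + ga * x ^+ 2).
    rewrite RintegralD//= RintegralD//=; last exact: icst.
    have -> : \int[nu]_x (be * x) = be * M1 by exact: (RintegralZl _ measurableT iid).
    have -> : \int[nu]_x (ga * x ^+ 2) = ga * M2.
      exact: (RintegralZl _ measurableT isq).
    congr (_ + _ + _); rewrite Rintegral_cst//.
    by rewrite [X in fine X](_ : _ = 1%E) ?mulr1//; exact: probability_setT.
    apply: le_trans (_ : \int[nu]_x expR (Q x) <= 1); last by rewrite IQ.
  apply: le_Rintegral => // x _.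
  have -> : al + be * x + ga * x ^+ 2 = 1 + Q x.
    by rewrite /al /be /ga /Q; field; rewrite !gt_eqF.
  exact: expR_ge1Dx.
have M10 : M1 = 0.
  have := gibbs M1 t t0; rewrite !subrr mulr0 mul0r addr0.
  have -> : 1 + 1 / 2 * (0 - M1 ^+ 2 / t) + M1 / t * M1 = 1 + M1 ^+ 2 / (2 * t).
    by field; rewrite gt_eqF.
  rewrite gerDl pmulr_lle0 ?invr_gt0 ?mulr_gt0// => h.
  by apply/eqP; rewrite -sqrf_eq0; apply/eqP/le_anti; rewrite h sqr_ge0.
split=> //.
have M20 : 0 <= M2 by apply: Rintegral_ge0 => x _; exact: sqr_ge0.
have [u uE] : exists u, u = (M2 + t) / 2 by exists ((M2 + t) / 2).
have u0 : 0 < u by rewrite uE divr_gt0// ltr_wpDl.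
have := gibbs 0 u u0; rewrite M10 mulr0 addr0 expr0n/= mul0r subr0.
have ln1 : ln u - ln t <= u / t - 1.
  by rewrite -ln_div ?posrE//; apply: ln_le_sub1; exact: divr_gt0.
move=> g.
have : (1 / t - 1 / u) * M2 <= u / t - 1 by lra.
have -> : (1 / t - 1 / u) * M2 = (u - t) * M2 / (t * u) by field; rewrite !gt_eqF.
have -> : u / t - 1 = (u - t) * u / (t * u) by field; rewrite !gt_eqF.
rewrite ler_pM2r ?invr_gt0 ?mulr_gt0//.
rewrite -subr_ge0 -mulrBr.
have -> : u - t = (M2 - t) / 2 by rewrite uE; field.
have -> : u - M2 = - ((M2 - t) / 2) by rewrite uE; field.
rewrite mulrN oppr_ge0 => h.
have : ((M2 - t) / 2) ^+ 2 = 0 by apply/le_anti; rewrite sqr_ge0 expr2 h.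
by move/eqP; rewrite sqrf_eq0 mulf_eq0 invr_eq0 pnatr_eq0 orbF subr_eq0 => /eqP.
Qed.

(** * Second moments of sums of independent observations *)

Lemma integral_separable d1 d2 (T1 : measurableType d1) (T2 : measurableType d2)
    (R : realType) (m1 : {sigma_finite_measure set T1 -> \bar R})
    (m2 : {sigma_finite_measure set T2 -> \bar R}) (f : T1 -> R) (g : T2 -> R) :
  m1.-integrable setT (EFin \o f) -> m2.-integrable setT (EFin \o g) ->
  (m1 \x m2)%E.-integrable setT (EFin \o (fun z => f z.1 * g z.2)) /\
  \int[(m1 \x m2)%E]_z (f z.1 * g z.2) = \int[m1]_x f x * \int[m2]_y g y.
Proof.
move=> /[dup] fi /integrableP[/measurable_EFinP mf fo].
move=> /[dup] gi /integrableP[/measurable_EFinP mg go].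
have mF : measurable_fun setT (fun z : T1 * T2 => f z.1 * g z.2).
  apply: measurable_funM; first exact: (measurableT_comp mf measurable_fst).
  exact: (measurableT_comp mg measurable_snd).
have int : (m1 \x m2)%E.-integrable setT (EFin \o (fun z => f z.1 * g z.2)).
  apply/integrableP; split; first by apply/measurable_EFinP.
  under eq_integral do rewrite /= normrM.
  rewrite (ge0_integral_separable _ _ _ _ _ _ _ (fun x => `|f x|) (fun y => `|g y|))//.
  - by apply: lte_mul_pinfty => //; [exact: integral_ge0|rewrite ge0_fin_numE// integral_ge0].
  - exact: measurableT_comp.
  - exact: measurableT_comp.
split=> //.
rewrite /Rintegral -integral12_prod_meas1//.
have gfin : (\int[m2]_y (g y)%:E \is a fin_num)%E by exact: integrable_fin_num.
transitivity (fine (\int[m1]_x ((f x)%:E * \int[m2]_y (g y)%:E))%E).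
  congr fine; apply: eq_integral => x _; rewrite /fubini_F/=.
  under eq_integral do rewrite EFinM.
  by rewrite integralZl.
rewrite -(fineK gfin) integralZr// fineM//.
exact: integrable_fin_num.
Qed.

Lemma integral_law d d' (T : measurableType d) (U : measurableType d') (R : realType)
    (P : probability T R) (X : {RV P >-> U}) (m : {measure set U -> \bar R}) (f : U -> R) :
  (forall A, measurable A -> distribution P X A = m A) ->
  m.-integrable setT (EFin \o f) ->
  P.-integrable setT (EFin \o (f \o X)) /\ \int[P]_t f (X t) = \int[m]_y f y.
Proof.
move=> lawX fi; have /integrableP[mf fo] := fi.
have int : P.-integrable setT (EFin \o (f \o X)).
  apply/integrableP; split; first exact: (measurableT_comp mf).
  have := @ge0_integral_distribution _ _ _ _ _ P X (fun y => `|(f y)%:E|)%E.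
  move=> /(_ (measurableT_comp (@abse_measurable R setT) mf) (fun=> abse_ge0 _)).
  rewrite /comp => <-.
  rewrite (eq_measure_integral m)// => A mA _; exact: lawX.
split=> //; rewrite /Rintegral; congr fine.
rewrite -(eq_measure_integral m (m1 := distribution P X)); last by move=> A mA _; exact: lawX.
by rewrite (integral_distribution mf int).
Qed.

Lemma measurable_superlevel d (T : measurableType d) (R : realType) (f : T -> R) (b : bool) (lam : R) :
  measurable_fun setT f -> measurable [set t | if b then lam < f t else lam <= f t].
Proof.
move=> mf.
rewrite (_ : [set t | _] = setT `&` f @^-1` [set` Interval (BSide (~~ b) lam) +oo%O]).
  by apply: mf => //; exact: measurable_itv.
by rewrite setTI; case: b; apply/seteqP; split => t /=; rewrite in_itv/= andbT.
Qed.

Section IndependentSums.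
Context d (T : measurableType d) (R : realType) (P : probability T R).
Context d' (U : measurableType d') (X : nat -> {RV P >-> U}).
Context (m : probability U R).
Hypothesis X_indep : mutually_independent X.
Hypothesis X_law : forall i A, measurable A -> distribution P (X i) A = m A.

Let pair_rv (i j : nat) : T -> U * U := fun t => (X i t, X j t).

Let measurable_pair_rv i j : measurable_fun setT (pair_rv i j).
Proof. exact: measurable_fun_pair. Qed.

HB.instance Definition _ i j :=
  isMeasurableFun.Build _ _ _ _ (pair_rv i j) (measurable_pair_rv i j).

(** Independence of two observations on rectangles determines their joint law.
    *)
Let pair_law i j : i != j -> forall A, measurable A ->
  distribution P (pair_rv i j : {RV P >-> (U * U)%type}) A = (m \x m)%E A.
Proof.
move=> ij A mA; apply/esym.
apply: (product_measure_unique (m' := distribution P (pair_rv i j))) => // B C mB mC.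
transitivity (P (X i @^-1` B) * P (X j @^-1` C))%E; last first.
  by congr (_ * _)%E; [exact: (X_law i)|exact: (X_law j)].
rewrite /distribution /pushforward.
pose F k := if k == i then B else C.
have mF k : measurable (F k) by rewrite /F; case: ifP.
have Fi : F i = B by rewrite /F eqxx.
have Fj : F j = C by rewrite /F eq_sym (negbTE ij).
have := @X_indep [fset i; j]%fset F mF.
rewrite (_ : \bigcap_(k in _) _ = pair_rv i j @^-1` (B `*` C)); last first.
  apply/seteqP; split => t /=.
    move=> h; split; [rewrite -Fi; apply: (h i)|rewrite -Fj; apply: (h j)];
      by rewrite /= !inE eqxx ?orbT.
  by move=> [hB hC] k; rewrite /= !inE => /orP[/eqP ->|/eqP ->]; rewrite ?Fi ?Fj.
move=> H; apply: (etrans H); rewrite big_fsetU1/= ?inE// big_seq_fset1.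
by rewrite Fi Fj.
Qed.

(** Distinct observations are uncorrelated, so that the second moment of the
    sum is [n] times that of one term. *)
Lemma sum_chebyshev (f : U -> R) (n : nat) (lam : R) : 0 < lam ->
  measurable_fun setT f ->
  m.-integrable setT (EFin \o f) -> m.-integrable setT (EFin \o (fun x => f x ^+ 2)) ->
  \int[m]_x f x = 0 ->
  (P [set t | lam <= `|\sum_(i < n) f (X i t)|]%R <=
    (n%:R * (\int[m]_x (f x ^+ 2)) / lam ^+ 2)%:E)%E.
Proof.
move=> lam0 mf fi f2i f0.
pose Z t := \sum_(i < n) f (X i t).
have mfX i : measurable_fun setT (fun t => f (X i t)) by exact: measurableT_comp.
have mZ : measurable_fun setT Z by exact: measurable_sum.
have prodi (i j : nat) : P.-integrable setT (EFin \o (fun t => f (X i t) * f (X j t))) /\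
    \int[P]_t (f (X i t) * f (X j t)) = if i == j then \int[m]_x (f x ^+ 2) else 0.
  have [->|ij] := eqVneq i j.
    have [h1 h2] := integral_law _ _ _ _ _ _ (X j) m (fun x => f x ^+ 2) (X_law j) f2i.
    split; last by rewrite -h2; apply: eq_Rintegral => t _; rewrite expr2.
    by apply: eq_integrable h1 => // t _; rewrite /= expr2.
  have [pi pE] := integral_separable _ _ _ _ _ m m f f fi fi.
  have [ii iE] := integral_law _ _ _ _ _ _ (pair_rv i j : {RV P >-> (U * U)%type})
    (m \x m)%E (fun z => f z.1 * f z.2) (pair_law i j ij) pi.
  by split=> //; apply: (etrans iE); rewrite pE f0 mul0r.
set V := \int[m]_x (f x ^+ 2) in prodi *.
have Z2E t : Z t ^+ 2 = \sum_(p : 'I_n * 'I_n) f (X p.1 t) * f (X p.2 t).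
  by rewrite expr2 /Z big_distrlr/= pair_bigA.
have IZ : (\int[P]_t (Z t ^+ 2)%:E = (n%:R * V)%:E)%E.
  under eq_integral do rewrite Z2E -sumEFin.
  rewrite integral_sum//; last by move=> p; have [] := prodi p.1 p.2.
  transitivity (\sum_(p : 'I_n * 'I_n) (if p.1 == p.2 then V else 0)%:E)%E.
    apply: eq_bigr => p _; have [h1 h2] := prodi p.1 p.2.
    have h3 : p.1 == p.2 = (p.1 == p.2 :> nat) by [].
    by rewrite h3 -h2 /Rintegral fineK//; exact: integrable_fin_num.
  rewrite sumEFin -(pair_bigA _ (fun i j : 'I_n => if i == j then V else 0))/=.
  congr EFin; rewrite (eq_bigr (fun=> V)).
    by rewrite sumr_const card_ord mulr_natl.
  by move=> i _; rewrite -big_mkcond (big_pred1 i)// => j; rewrite /= eq_sym.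
pose A := [set t | lam <= `|Z t|].
have mA : measurable A.
  apply: (measurable_superlevel _ _ _ _ false).
  exact: (measurableT_comp (@normr_measurable R setT) mZ).
have lam2 : 0 < lam ^+ 2 by rewrite exprn_gt0.
rewrite mulrC EFinM lee_pdivlMl//.
have mZ2 : measurable_fun setT (fun t => (Z t ^+ 2)%:E).
  by apply/measurable_EFinP; exact: measurable_funX.
have := integral_cst P mA (lam ^+ 2)%:E; rewrite -IZ => <-.
apply: (@le_trans _ _ (\int[P]_(t in A) (Z t ^+ 2)%:E)%E).
  apply: ge0_le_integral => //.
  - by move=> t _; rewrite lee_fin ltW.
  - exact: measurable_funS mZ2.
  - move=> t /= h; rewrite lee_fin -[leRHS]real_normK ?num_real// ler_sqr ?nnegrE//.
    exact: ltW.
by apply: ge0_subset_integral => // t _; rewrite lee_fin sqr_ge0.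
Qed.
End IndependentSums.

Lemma integrable_quadratic_growth {R : realType} (s c : R) (g : R -> R) : s != 0 ->
  measurable_fun setT g -> (forall x, `|g x| <= c * (1 + x ^+ 2)) ->
  (normal_prob 0%R s).-integrable setT (fun x : measurableTypeR R => (g x)%:E) /\
  (normal_prob 0%R s).-integrable setT (fun x : measurableTypeR R => (g x ^+ 2)%:E).
Proof.
move=> s0 mg hg.
have c0 : 0 <= c.
  by have := hg 0; rewrite expr0n/= addr0 mulr1; apply: le_trans.
split.
  apply: (@integrable_le_pow4 _ _ (2 * c)) => // x; apply: (le_trans (hg x)).
  have -> : 2 * c * (1 + x ^+ 4) = c * (2 * (1 + x ^+ 4)) by ring.
  apply: ler_wpM2l => //.
  have := sqr_ge0 (x ^+ 2 - 1); have := sqr_ge0 (x ^+ 2); nra.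
apply: (@integrable_le_pow4 _ _ (2 * c ^+ 2)) => //; first exact: measurable_funX.
move=> x; rewrite normrX.
apply: (@le_trans _ _ ((c * (1 + x ^+ 2)) ^+ 2)).
  by rewrite ler_sqr ?nnegrE// mulr_ge0// addr_ge0// sqr_ge0.
have -> : 2 * c ^+ 2 * (1 + x ^+ 4) = c ^+ 2 * (2 * (1 + x ^+ 4)) by ring.
rewrite exprMn; apply: ler_wpM2l; first exact: sqr_ge0.
have := sqr_ge0 (x ^+ 2 - 1); nra.
Qed.

Lemma sq_centered_growth {R : realType} (t : R) : 0 < t ->
  forall x : R, `|x ^+ 2 - t| <= (1 + t) * (1 + x ^+ 2).
Proof.
move=> t0 x; have x2 := sqr_ge0 x.
by rewrite ler_norml; apply/andP; split; nra.
Qed.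

Lemma cst_growth {R : realType} (t : R) : 0 < t ->
  forall x : R, `|1 : R| <= (1 + t) * (1 + x ^+ 2).
Proof. by move=> t0 x; have x2 := sqr_ge0 x; rewrite normr1; nra. Qed.

Lemma id_growth {R : realType} (x : R) : `|x| <= 1 * (1 + x ^+ 2).
Proof.
rewrite mul1r ler_norml; apply/andP; split.
  by have := sqr_ge0 (x + 1); have := sqr_ge0 x; nra.
by have := sqr_ge0 (x - 1); have := sqr_ge0 x; nra.
Qed.

Lemma measurable_sq_centered {R : realType} (t : R) :
  measurable_fun setT (fun x : R => x ^+ 2 - t).
Proof. by apply: measurable_funB => //; exact: measurable_funX. Qed.

Lemma sq_centered_mean {R : realType} (t : R) : 0 < t ->
  \int[normal_prob 0%R (Num.sqrt t)]_x (x ^+ 2 - t) = 0.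
Proof.
move=> t0; have [_ M2] := normal_moments _ t0.
have s0 : Num.sqrt t != 0 by rewrite sqrtr_eq0 -ltNge.
have msq : measurable_fun setT (fun x : R => x ^+ 2) by exact: measurable_funX.
have sq_le (x : R) : `|x ^+ 2| <= 1 * (1 + x ^+ 2).
  by rewrite mul1r ger0_norm ?sqr_ge0// lerDr.
have cst_le (x : R) : `|t| <= `|t| * (1 + x ^+ 2).
  by rewrite ler_peMr// lerDl sqr_ge0.
have [sqi _] := integrable_quadratic_growth _ _ _ s0 msq sq_le.
have [ci _] := integrable_quadratic_growth _ _ _ s0 (measurable_cst t) cst_le.
rewrite RintegralB//= M2 Rintegral_cst//.
by rewrite [X in fine X](_ : _ = 1%E) ?mulr1 ?subrr//; exact: probability_setT.
Qed.

Section Observations.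
Context (R : realType) (d : measure_display) (T : measurableType d)
    (P : probability T R) (X : nat -> {RV P >-> (R * R)%type}) (t1 t2 : R).
Hypotheses (t1_gt0 : 0 < t1) (t2_gt0 : 0 < t2).
Hypothesis X_indep : mutually_independent X.
Hypothesis X_law : forall i, has_law (X i) (model_law S3 (0, (t1, t2))).

Let nu1 : probability _ R := normal_prob 0%R (Num.sqrt t1).
Let nu2 : probability _ R := normal_prob 0%R (Num.sqrt t2).
Let plane : measurableType _ := (measurableTypeR R * measurableTypeR R)%type.

(** The observation with values in the product of two copies of the Borel line
    on which the normal laws live; this plane has the same measurable sets as
    [R * R]. *)
Let observation (i : nat) : T -> plane := X i.

Let measurable_observation i : measurable_fun setT (observation i).
Proof. exact: (measurable_funPT (X i)). Qed.

HB.instance Definition _ i :=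
  isMeasurableFun.Build _ _ _ _ (observation i) (measurable_observation i).

Let observation_rv (i : nat) : {RV P >-> plane} := observation i.

Let observation_indep : mutually_independent observation_rv.
Proof. by move=> J A mA; exact: (X_indep J A mA). Qed.

Let observation_law i A : measurable A ->
  distribution P (observation_rv i) A = (nu1 \x nu2)%E A.
Proof. by move=> mA; exact: (X_law i A mA). Qed.

(** The three statistics are products of a function of the first coordinate
    and a function of the second, so that all moments factor. Quadratic growth
    of the factors makes their squares integrable, by the finiteness of the
    fourth moment. *)
Lemma coordinate_chebyshev (c : R) (g h : R -> R) :
  measurable_fun setT g -> measurable_fun setT h ->
  (forall x, `|g x| <= c * (1 + x ^+ 2)) -> (forall x, `|h x| <= c * (1 + x ^+ 2)) ->
  (\int[nu1]_x g x) * (\int[nu2]_x h x) = 0 ->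
  exists V : R, forall n lam, 0 < lam ->
    (P [set t | lam <= `|\sum_(i < n) g (X i t).1 * h (X i t).2|]%R <=
    (n%:R * V / lam ^+ 2)%:E)%E.
Proof.
move=> mg mh hg hh gh0.
have s1 : Num.sqrt t1 != 0 by rewrite sqrtr_eq0 -ltNge.
have s2 : Num.sqrt t2 != 0 by rewrite sqrtr_eq0 -ltNge.
have [gi g2i] := integrable_quadratic_growth _ _ _ s1 mg hg.
have [hi h2i] := integrable_quadratic_growth _ _ _ s2 mh hh.
have [fi fE] := integral_separable _ _ _ _ _ nu1 nu2 g h gi hi.
have [f2i f2E] := integral_separable _ _ _ _ _ nu1 nu2 _ _ g2i h2i.
pose f (z : R * R) := g z.1 * h z.2.
have mf : measurable_fun setT f.
  apply: measurable_funM; first exact: (measurableT_comp mg measurable_fst).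
  exact: (measurableT_comp mh measurable_snd).
have f2i' : (nu1 \x nu2)%E.-integrable setT (EFin \o (fun z => f z ^+ 2)).
  by apply: eq_integrable f2i => // z _; rewrite /= /f exprMn.
exists (\int[(nu1 \x nu2)%E]_z (f z ^+ 2)) => n lam lam0.
have f0 : \int[(nu1 \x nu2)%E]_z f z = 0 by exact: (etrans fE gh0).
have := @sum_chebyshev _ _ _ P _ _ observation_rv (nu1 \x nu2)%E
  observation_indep observation_law f n lam lam0 mf fi f2i' f0.
exact.
Qed.

Lemma sq1_chebyshev : exists V : R, forall n lam, 0 < lam ->
  (P [set t | lam <= `|\sum_(i < n) (sq1 (X i t) - t1)|]%R <= (n%:R * V / lam ^+ 2)%:E)%E.
Proof.
have [] := coordinate_chebyshev (1 + t1) (fun x => x ^+ 2 - t1) (fun=> 1)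
  (measurable_sq_centered t1) (measurable_cst _)
  (sq_centered_growth _ t1_gt0) (cst_growth _ t1_gt0).
  by rewrite sq_centered_mean// mul0r.
move=> V H; exists V => n lam lam0; apply: le_trans (H n lam lam0).
rewrite le_eqVlt; apply/orP; left; apply/eqP; congr (P _).
by apply/funext => t /=; under [in RHS]eq_bigr do rewrite mulr1.
Qed.

Lemma sq2_chebyshev : exists V : R, forall n lam, 0 < lam ->
  (P [set t | lam <= `|\sum_(i < n) (sq2 (X i t) - t2)|]%R <= (n%:R * V / lam ^+ 2)%:E)%E.
Proof.
have [] := coordinate_chebyshev (1 + t2) (fun=> 1) (fun x => x ^+ 2 - t2)
  (measurable_cst _) (measurable_sq_centered t2)
  (cst_growth _ t2_gt0) (sq_centered_growth _ t2_gt0).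
  by rewrite sq_centered_mean// mulr0.
move=> V H; exists V => n lam lam0; apply: le_trans (H n lam lam0).
rewrite le_eqVlt; apply/orP; left; apply/eqP; congr (P _).
by apply/funext => t /=; under [in RHS]eq_bigr do rewrite mul1r.
Qed.

Lemma cross_chebyshev : exists V : R, forall n lam, 0 < lam ->
  (P [set t | lam <= `|\sum_(i < n) cross (X i t)|]%R <= (n%:R * V / lam ^+ 2)%:E)%E.
Proof.
have [M1 _] := normal_moments _ t1_gt0.
have [] := coordinate_chebyshev 1 id id
  (@measurable_id _ _ setT) (@measurable_id _ _ setT) id_growth id_growth.
  by rewrite [X in X * _]M1 mul0r.
by move=> V H; exists V => n lam /(H n).
Qed.
End Observations.

(** * Measurability of the posterior in the data *)

(** The integral of a jointly measurable nonnegative function is measurable in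
    the parameter, by Tonelli's theorem. Cutting the density [p] off outside
    [D] reduces an integral over [D], on which [f] and [L] agree, to one over
    the whole space. *)
Lemma measurable_param_integral d (T : measurableType d) (R : realType)
    d' (V : measurableType d') (mu : {sigma_finite_measure set V -> \bar R})
    (D : set V) (L : T * V -> R) (f : T -> V -> R) (p : V -> R) :
  measurable D -> measurable_fun D p -> (forall v, D v -> 0 <= p v) ->
  measurable_fun setT L -> (forall z, 0 <= L z) ->
  (forall t v, D v -> f t v = L (t, v)) ->
  measurable_fun setT (fun t => \int[mu]_(v in D) (f t v * p v)).
Proof.
move=> mD mp p0 mL L0 fL.
pose F (z : T * V) := (L z * (p \_ D) z.2)%:E.
have mF : measurable_fun setT F.
  apply/measurable_EFinP; apply: measurable_funM => //.
  by apply: (measurableT_comp _ measurable_snd); apply/(measurable_restrictT _ mD).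
have F0 z : (0 <= F z)%E.
  rewrite lee_fin mulr_ge0// patchE; case: ifPn => // /set_mem; exact: p0.
have := measurable_fun_fubini_tonelli_F (m2 := mu) F mF F0.
move=> mI; rewrite /Rintegral.
apply: (eq_measurable_fun (fun t => fine (fubini_F mu F t))).
  move=> t _; congr fine; rewrite /fubini_F [RHS]integral_mkcond.
  apply: eq_integral => v _; rewrite /F patchE [in RHS]patchE.
  by case: ifPn => [/set_mem Dv|_]; rewrite ?mulr0// fL.
exact: measurableT_comp.
Qed.

Lemma measurable_statistics (R : realType) :
  [/\ measurable_fun setT (@sq1 R), measurable_fun setT (@sq2 R) &
      measurable_fun setT (@cross R)].
Proof.
split.
- by apply: measurable_funX; exact: measurable_fst.
- by apply: measurable_funX; exact: measurable_snd.
- by apply: measurable_funM; [exact: measurable_fst|exact: measurable_snd].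
Qed.

Section PosteriorMeasurable.
Context (R : realType) (d : measure_display) (T : measurableType d)
    (X : nat -> T -> R * R) (mX : forall i, measurable_fun setT (X i)).
Context (pi1 pi2 : R * (R * R) -> R) (pi3 : R * R -> R).
Hypotheses (h1 : is_prob_density (@lebesgue3 R) param_space pi1)
  (h2 : is_prob_density (@lebesgue3 R) param_space pi2)
  (h3 : is_prob_density (@lebesgue2 R) variance_space pi3).

Lemma measurable_mean_of (g : R * R -> R) n : measurable_fun setT g ->
  measurable_fun setT (fun t => mean_of g n (fun i => X i t)).
Proof.
move=> mg; apply: measurable_funM => //; apply: measurable_sum => i.
exact: measurableT_comp.
Qed.

Lemma measurable_evidence n S :
  measurable_fun setT (fun t => evidence pi1 pi2 pi3 n (fun i => X i t) S).
Proof.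
have [m1 m2 m3] := measurable_statistics R.
have ms (d' : measure_display) (V : measurableType d') (th : T * V -> R * (R * R)) S' :
    measurable_fun setT th ->
    measurable_fun setT (fun z : T * V => expR (- (n%:R / 2) * structure_deviance S'
      (mean_of sq1 n (fun i => X i z.1)) (mean_of sq2 n (fun i => X i z.1))
      (mean_of cross n (fun i => X i z.1)) (th z))).
  move=> mth; apply: (measurableT_comp (@measurable_expR R)).
  apply: measurable_funM => //; apply: measurable_structure_deviance => //.
  - exact: (measurableT_comp (measurable_mean_of _ n m1) measurable_fst).
  - exact: (measurableT_comp (measurable_mean_of _ n m2) measurable_fst).
  - exact: (measurableT_comp (measurable_mean_of _ n m3) measurable_fst).
case: S => /=.
- case: h1 => mp p0 _.
  apply: (measurable_param_integral _ _ _ _ _ _ _ _ _ _ _ mp p0 (ms _ _ snd S1 _)) => //.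
  + exact: measurable_param_space.
  + by move=> t th Dth; exact: likelihoodE.
- case: h2 => mp p0 _.
  apply: (measurable_param_integral _ _ _ _ _ _ _ _ _ _ _ mp p0 (ms _ _ snd S2 _)) => //.
  + exact: measurable_param_space.
  + by move=> t th Dth; exact: likelihoodE.
- case: h3 => mp p0 _.
  apply: (measurable_param_integral _ _ _ _ _ _ _ _ _ _ _ mp p0
    (ms _ _ (fun z => (0, z.2)) S3 _)) => //.
  + exact: measurable_variance_space.
  + by apply: measurable_fun_pair => //; exact: measurable_snd.
  + by move=> t th Dth; exact: likelihoodE.
Qed.

Lemma measurable_posterior n S :
  measurable_fun setT (fun t => posterior pi1 pi2 pi3 n (fun i => X i t) S).
Proof.
apply: measurable_funM; first exact: measurable_evidence.
apply: measurable_funV.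
under eq_fun do rewrite !big_cons big_nil.
by do 3! [apply: measurable_funD; first exact: measurable_evidence].
Qed.
End PosteriorMeasurable.

(** * Conclusion *)

Theorem theorem3p2 (R : realType) (d : measure_display) (T : measurableType d)
    (P : probability T R) (X : nat -> {RV P >-> (R * R)%type}) (t1 t2 : R)
    (pi1 pi2 : R * (R * R) -> R) (pi3 : R * R -> R)
    (t1_gt0 : 0 < t1) (t2_gt0 : 0 < t2)
    (X_indep : mutually_independent X)
    (X_law : forall i, has_law (X i) (model_law S3 (0, (t1, t2))))
    (pi1_density : is_prob_density (@lebesgue3 R) param_space pi1)
    (pi2_density : is_prob_density (@lebesgue3 R) param_space pi2)
    (pi3_density : is_prob_density (@lebesgue2 R) variance_space pi3)
    (pi1_diff : times_differentiable 4 param_space pi1)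
    (pi2_diff : times_differentiable 4 param_space pi2)
    (pi3_diff : times_differentiable 4 variance_space pi3)
    (pi3_gt0 : 0 < pi3 (t1, t2)) :
  bounded_in_probability P (fun n w =>
    Num.sqrt n%:R * (1 - posterior pi1 pi2 pi3 n (fun i => X i w) S3)).
Proof.
have truth : variance_space (t1, t2) by [].
have [d1 _] := pi1_diff; have [d2 _] := pi2_diff; have [d3 _] := pi3_diff.
have [eta eta0 H] := posterior_bound t1 t2 pi1 pi2 pi3 t1_gt0 t2_gt0
  pi1_density pi2_density pi3_density (d1 (0, (t1, t2)) truth)
  (d2 (0, (t1, t2)) truth) (d3 (t1, t2) truth) pi3_gt0.
move=> e e0.
have [V1 H1] := sq1_chebyshev _ _ _ _ _ _ _ t1_gt0 t2_gt0 X_indep X_law.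
have [V2 H2] := sq2_chebyshev _ _ _ _ _ _ _ t1_gt0 t2_gt0 X_indep X_law.
have [V3 H3] := cross_chebyshev _ _ _ _ _ _ _ t1_gt0 t2_gt0 X_indep X_law.
(* With [n (K + 1)] as the square of the threshold for the sum of the
   products, Chebyshev's bound is [V3 / (K + 1) <= e / 3] for every [n]; the
   bounds for the squares tend to zero. *)
pose K := 3 * `|V3| / e.
have K0 : 0 <= K by rewrite divr_ge0 ?mulr_ge0 ?(ltW e0).
have [M HM] := H (K + 1) (addr_ge0 K0 ler01).
exists M; near=> n.
have n0 : (0 < n)%N by near: n; exists 1%N.
have nR : 0 < n%:R :> R by rewrite ltr0n.
have hn : forall x : nat -> R * R,
    `|mean_of sq1 n x - t1| <= eta -> `|mean_of sq2 n x - t2| <= eta ->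
    n%:R * mean_of cross n x ^+ 2 <= K + 1 ->
    `|Num.sqrt n%:R * (1 - posterior pi1 pi2 pi3 n x S3)| <= M by near: n.
pose Y t := Num.sqrt n%:R * (1 - posterior pi1 pi2 pi3 n (fun i => X i t) S3).
have mX i : measurable_fun setT (X i) by exact: measurable_funPT.
have [ms1 ms2 ms3] := measurable_statistics R.
have msum (g : R * R -> R) : measurable_fun setT g ->
    measurable_fun setT (fun w => \sum_(i < n) g (X i w)).
  by move=> mg; apply: measurable_sum => i; exact: measurableT_comp.
have mcen (g : R * R -> R) t : measurable_fun setT g ->
    measurable_fun setT (fun w => \sum_(i < n) (g (X i w) - t)).
  by move=> mg; apply: (msum (fun z => g z - t)); exact: measurable_funB.
have mnorm (g : T -> R) : measurable_fun setT g -> measurable_fun setT (fun w => `|g w|).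
  by move=> mg; exact: (measurableT_comp (@normr_measurable R setT) mg).
have mY : measurable_fun setT Y.
  by apply: measurable_funM => //; apply: measurable_funB => //; exact: measurable_posterior.
pose l3 := Num.sqrt (n%:R * (K + 1)).
have l30 : 0 < l3 by rewrite sqrtr_gt0 mulr_gt0// ltr_wpDl.
pose A1 := [set w | n%:R * eta <= `|\sum_(i < n) (sq1 (X i w) - t1)|].
pose A2 := [set w | n%:R * eta <= `|\sum_(i < n) (sq2 (X i w) - t2)|].
pose A3 := [set w | l3 <= `|\sum_(i < n) cross (X i w)|].
have mA1 : measurable A1.
  exact: (measurable_superlevel _ _ _ _ false _ (mnorm _ (mcen _ t1 ms1))).
have mA2 : measurable A2.
  exact: (measurable_superlevel _ _ _ _ false _ (mnorm _ (mcen _ t2 ms2))).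
have mA3 : measurable A3.
  exact: (measurable_superlevel _ _ _ _ false _ (mnorm _ (msum _ ms3))).
have mB : measurable [set w | M < `|Y w|].
  exact: (measurable_superlevel _ _ _ _ true _ (mnorm _ mY)).
have sub : [set w | M < `|Y w|] `<=` A1 `|` A2 `|` A3.
  move=> w /= MY; apply: contrapT => /not_orP[/not_orP[nA1 nA2] nA3].
  move: MY; apply/negP; rewrite -leNgt.
  apply: hn.
  - move: nA1 => /negP; rewrite -ltNge (sum_centered sq1 n (fun i => X i w)) normrM (gtr0_norm nR).
    by rewrite ltr_pM2l// => /ltW.
  - move: nA2 => /negP; rewrite -ltNge (sum_centered sq2 n (fun i => X i w)) normrM (gtr0_norm nR).
    by rewrite ltr_pM2l// => /ltW.
  - move: nA3 => /negP; rewrite -ltNge (sum_mean_of cross n (fun i => X i w)).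
    rewrite -ltr_sqr ?nnegrE ?(ltW l30)// real_normK ?num_real//.
    rewrite /l3 sqr_sqrtr ?mulr_ge0 ?addr_ge0 ?(ltW nR)// exprMn expr2 -mulrA ltr_pM2l//.
    exact: ltW.
have n_eta : 0 < n%:R * eta by exact: mulr_gt0.
apply: (@le_trans _ _ (P A1 + P A2 + P A3)%E).
  apply: (@le_trans _ _ (P (A1 `|` A2 `|` A3))).
    by apply: le_measure => //; rewrite inE//; do 2?[apply: measurableU => //].
  apply: (le_trans (measureU2 _ _ _)) => //; first exact: measurableU.
  by apply: leeD => //; exact: measureU2.
have -> : e%:E = ((e / 3)%:E + (e / 3)%:E + (e / 3)%:E)%E.
  by rewrite -!EFinD; congr EFin; field.
have chase V : n%:R * V / (n%:R * eta) ^+ 2 = V / eta ^+ 2 / n%:R.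
  by field; rewrite !gt_eqF.
apply: leeD; first apply: leeD.
- apply: (le_trans (H1 n _ n_eta)); rewrite chase lee_fin.
  by near: n; apply: near_div_le; rewrite divr_gt0.
- apply: (le_trans (H2 n _ n_eta)); rewrite chase lee_fin.
  by near: n; apply: near_div_le; rewrite divr_gt0.
- apply: (le_trans (H3 n _ l30)); rewrite lee_fin /l3 sqr_sqrtr; last first.
    by rewrite mulr_ge0 ?addr_ge0 ?(ltW nR).
  have -> : n%:R * V3 / (n%:R * (K + 1)) = V3 / (K + 1).
    by field; rewrite !gt_eqF// ltr_wpDl.
  rewrite ler_pdivrMr; last by rewrite ltr_wpDl.
  have -> : e / 3 * (K + 1) = `|V3| + e / 3 by rewrite /K; field; rewrite gt_eqF.
  have := ler_norm V3; lra.
Unshelve. all: by end_near. Qed.
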